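(* Assume that $\ell\ne1$, or that $\ell=1$ and $k_1<N$. Let $e_1,\dots,e_N$ be the standard basis of $\mathbb{R}^N$, let $$\mathcal{A}_i=\Big\{\sum_{j=1}^{i-1}k_j+1,\dots,\sum_{j=1}^{i}k_j\Big\},\quad i=1,\dots,\ell,$$ and let $$u(x)=\begin{cases}0&\text{if }|x|\le1,\text{ or if }x\in\langle e_j\rangle_{j\in\mathcal{A}_i}\text{ for some }i\in\{1,\dots,\ell\},\\-1&\text{otherwise.}\end{cases}$$ Set $\Omega=B_1(0)$. Then the map $x\in\Omega\mapsto\mathcal{K}^+_{k_1,\dots,k_\ell}u(x)$ is well defined and is not continuous at $x=0$.
   Context: Fix $N\in\mathbb{N}$, $s\in(0,1)$, $1\le\ell\le N$ and integers $1\le k_1\le\dots\le k_\ell\le N$ with $k:=\sum_{j=1}^\ell k_j\le N$. The symbol $\langle\cdot\rangle$ denotes linear span. For an $n$-dimensional linear subspace $V\subset\mathbb{R}^N$, $$\mathcal{J}_Vu(x)=C_{n,s}\,P.V.\int_V\frac{u(x+z)-u(x)}{|z|^{n+2s}}\,d\mathcal{H}^n(z),$$ where $C_{n,s}>0$ is a fixed normalizing constant depending only on $n,s$. For $u\in L^\infty(\mathbb{R}^N)\cap C^2(\Omega)$ and $x\in\Omega$, $\mathcal{K}^+_{k_1,\dots,k_\ell}u(x)$ is the supremum of $\sum_{i=1}^\ell\mathcal{J}_{V_i}u(x)$ over all families $(V_1,\dots,V_\ell)$ of pairwise orthogonal linear subspaces of $\mathbb{R}^N$ with $\dim V_i=k_i$.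 *)

(* Defs.v *)
From HB Require Import structures.
From mathcomp Require Import all_boot all_order all_algebra.
From mathcomp Require Import all_classical all_reals all_analysis.

Set Implicit Arguments.
Unset Strict Implicit.
Unset Printing Implicit Defensive.

Import Order.TTheory GRing.Theory Num.Theory.
Import numFieldNormedType.Exports.

Local Open Scope classical_set_scope.
Local Open Scope ring_scope.

(* The norm that the library puts on 'rV[R]_N is the sup norm: it induces the
   right topology, but Euclidean lengths have to be defined separately. *)
Section Euclidean.
Context {R : realType} {N : nat}.
Implicit Types v w : 'rV[R]_N.

Definition edot v w : R := \sum_(m < N) v 0 m * w 0 m.

Definition enorm v : R := Num.sqrt (edot v v).

Definition eball (r : R) : set 'rV[R]_N := [set v | enorm v < r].

Definition ebasis (m : 'I_N) : 'rV[R]_N := delta_mx 0 m.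

Definition orthogonal_vs (V W : {vspace 'rV[R]_N}) : Prop :=
  forall v w, v \in V -> w \in W -> edot v w = 0.

(* -oo on the empty set *)
Definition ediam (U : set 'rV[R]_N) : \bar R :=
  ereal_sup [set (enorm (p.1 - p.2))%:E | p in U `*` U].

(* meaningful for D open *)
Definition C2_on (D : set 'rV[R]_N) (f : 'rV[R]_N -> R) : Prop :=
  forall x, D x ->
    {for x, continuous f} /\
    forall m, [/\ derivable f x (ebasis m),
      {for x, continuous ('D_(ebasis m) f)} &
      forall p, derivable ('D_(ebasis m) f) x (ebasis p) /\
                {for x, continuous ('D_(ebasis p) ('D_(ebasis m) f))}].

End Euclidean.

(* Outer measures obtained from countable covers by sets satisfying P. *)
Section CoverOuter.
Local Open Scope ereal_scope.
Context {R : realType} {T : Type}.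
Variables (P : set (set T)) (g : set T -> \bar R).

Definition cover_outer (A : set T) : \bar R :=
  ereal_inf [set \sum_(i <oo) g (F i) |
    F in [set F : (set T)^nat | (forall i, P (F i)) /\ A `<=` \bigcup_i F i]].

Hypotheses (P0 : P set0) (g0 : g set0 = 0) (g_ge0 : forall A, 0 <= g A).

Lemma cover_outer_ge0 A : 0 <= cover_outer A.
Proof.
by apply: le_ereal_inf_tmp => _ [F _ <-]; apply: nneseries_ge0 => *; exact: g_ge0.
Qed.

Lemma cover_outer0 : cover_outer set0 = 0.
Proof.
apply/eqP; rewrite eq_le cover_outer_ge0 andbT.
apply: ereal_inf_lbound; exists (fun=> set0); first by split.
by rewrite eseries0.
Qed.

Lemma le_cover_outer : {homo cover_outer : A B / A `<=` B >-> A <= B}.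
Proof.
move=> A B AB; apply/ereal_inf_le_tmp => _ [F [PF BF] <-].
by exists F => //; split => //; exact: subset_trans AB BF.
Qed.

Lemma cover_outer_sigma_subadditive : sigma_subadditive cover_outer.
Proof.
move=> A; have [[i ioo]|] := pselect (exists i, cover_outer (A i) = +oo).
  rewrite (eseries_pinfty _ _ ioo) ?leey// => n _.
  by rewrite -ltNye (lt_le_trans _ (cover_outer_ge0 _)).
rewrite -forallNE => Aoo.
suff add2e (e : {posnum R}) : cover_outer (\bigcup_n A n) <=
    \sum_(i <oo) cover_outer (A i) + e%:num%:E.
  by apply/lee_addgt0Pr => _/posnumP[].
rewrite (le_trans _ (epsilon_trick _ _ _))//; last first.
  by move=> n; exact: cover_outer_ge0.
pose Q n (B : (set T)^nat) :=
  ((forall i, P (B i)) /\ A n `<=` \bigcup_i B i) /\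
  \sum_(k <oo) g (B k) <= cover_outer (A n) + (e%:num / (2 ^ n.+1)%:R)%:E.
have [G QG] : {G : ((set T)^nat)^nat & forall n, Q n (G n)}.
  apply: (@choice _ _ Q) => n; rewrite /Q.
  have fin : cover_outer (A n) \is a fin_num.
    by rewrite ge0_fin_numE ?cover_outer_ge0// ltey; exact/eqP/Aoo.
  have en1 : (0 < e%:num / (2 ^ n.+1)%:R)%R by [].
  have [_ [B PB <-] Blt] := lb_ereal_inf_adherent en1 fin.
  by exists B; split => //; exact/ltW.
have gG_ge0 x : 0 <= (g \o uncurry G) x by exact: g_ge0.
apply: (@le_trans _ _ (\esum_(i in setT) (g \o uncurry G) i)).
  apply: ereal_inf_lbound => /=.
  have /card_esym/ppcard_eqP[f] := card_nat2.
  exists (uncurry G \o f).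
    split => [i|]; first by rewrite /comp; case: (f i) => a b; exact: (QG a).1.1.
    apply: (@subset_trans _ (\bigcup_n \bigcup_k G n k)) => [t [i _]|].
      by move=> /((QG i).1.2) -[j _ ?]; exists i => //; exists j.
    move=> t [i _ [j _ Bijt]]; exists (f^-1%FUN (i, j)) => //=.
    by rewrite invK ?inE.
  rewrite -(esum_pred_image (g \o uncurry G) _ xpredT) ?[fun=> _]set_true//.
  by rewrite image_eq.
rewrite (_ : esum _ _ = \sum_(i <oo) \sum_(j <oo) g (G i j)); last first.
  pose J : nat -> set (nat * nat) := fun i => [set (i, j) | j in setT].
  rewrite (_ : setT = \bigcup_k J k); last first.
    by rewrite predeqE => -[a b]; split => // _; exists a => //; exists b.
  rewrite esum_bigcupT //=; last first.
    apply/trivIsetP => i j _ _ ij.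
    rewrite predeqE => -[n m] /=; split => //= -[] [_] _ [<-{n} _].
    by move=> [m' _] [] /esym/eqP; rewrite (negbTE ij).
  rewrite -(image_id [set: nat]) -fun_true esum_pred_image//; last first.
    by move=> n _; exact: esum_ge0.
  apply: eq_eseriesr => /= j _.
  rewrite -(esum_pred_image (g \o uncurry G) (pair j) predT)//=; last first.
    by move=> ? ? _ _; exact: (@can_inj _ _ _ snd).
  by congr esum; rewrite predeqE => -[a b]; split; move=> [i _ <-]; exists i.
apply: lee_lim.
- apply: is_cvg_nneseries => n *.
  by apply: nneseries_ge0 => m *; exact: (gG_ge0 (n, m)).
- by apply: is_cvg_nneseries => n *; apply: adde_ge0 => //; exact: cover_outer_ge0.
- by near=> n; apply: lee_sum => i _; exact: (QG i).2.
Unshelve. all: by end_near. Qed.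

End CoverOuter.

Section Hausdorff.
Local Open Scope ereal_scope.
Context {R : realType} {N : nat}.

(* Volume of the unit ball of R^n, by omega_(n+2) = (2 pi / (n+2)) omega_n. *)
Fixpoint unit_ball_volume (n : nat) : R :=
  match n with
  | 0%N => 1
  | 1%N => 2
  | m.+2 => (2 * pi / m.+2%:R * unit_ball_volume m)%R
  end.

(* The empty set needs a separate clause because x ^+ 0 = 1. *)
Definition hausdorff_gauge (n : nat) (U : set 'rV[R]_N) : \bar R :=
  if U == set0 then 0
  else (unit_ball_volume n / 2 ^+ n)%:E * ediam U ^+ n.

Definition hausdorff_delta (n : nat) (delta : R) : set 'rV[R]_N -> \bar R :=
  cover_outer [set U | ediam U <= delta%:E] (hausdorff_gauge n).

(* n-dimensional Hausdorff (outer) measure on R^N, normalized so that it is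
   Lebesgue measure when n = N. *)
Definition hausdorff (n : nat) (A : set 'rV[R]_N) : \bar R :=
  ereal_sup [set hausdorff_delta n delta A | delta in [set d : R | (0 < d)%R]].

Lemma unit_ball_volume_ge0 n : (0 <= unit_ball_volume n)%R.
Proof.
suff : (0 <= unit_ball_volume n)%R /\ (0 <= unit_ball_volume n.+1)%R by case.
elim: n => [|n [IH1 IH2]] //; split => //=.
by rewrite mulr_ge0// divr_ge0// mulr_ge0// pi_ge0.
Qed.

Lemma hausdorff_gauge_ge0 n U : 0 <= hausdorff_gauge n U.
Proof.
rewrite /hausdorff_gauge; case: ifPn => // /set0P[v Uv].
rewrite mule_ge0//; first by rewrite lee_fin divr_ge0// ?unit_ball_volume_ge0.
apply: expe_ge0; apply: (@le_trans _ _ (enorm (v - v))%:E).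
  by rewrite lee_fin sqrtr_ge0.
by apply: ereal_sup_ubound; exists (v, v).
Qed.

Lemma hausdorff_gauge0 n : hausdorff_gauge n set0 = 0.
Proof. by rewrite /hausdorff_gauge eqxx. Qed.

Lemma ediam_set0_le (d : R) : ediam (set0 : set 'rV[R]_N) <= d%:E.
Proof. by rewrite /ediam setX0 image_set0 ereal_sup0 leNye. Qed.

Lemma hausdorff_ge0 n A : 0 <= hausdorff n A.
Proof.
apply: (@le_trans _ _ (hausdorff_delta n 1 A)).
  exact/cover_outer_ge0/hausdorff_gauge_ge0.
by apply: ereal_sup_ubound; exists 1%R => //=; rewrite ltr01.
Qed.

Lemma hausdorff0 n : hausdorff n set0 = 0.
Proof.
apply/eqP; rewrite eq_le hausdorff_ge0 andbT.
apply: ge_ereal_sup => _ [d _ <-].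
rewrite /hausdorff_delta cover_outer0//.
- exact: ediam_set0_le.
- exact: hausdorff_gauge0.
- exact: hausdorff_gauge_ge0.
Qed.

Lemma le_hausdorff n : {homo hausdorff n : A B / A `<=` B >-> A <= B}.
Proof.
move=> A B AB; apply: ge_ereal_sup => _ [d d0 <-].
apply: (@le_trans _ _ (hausdorff_delta n d B)); first exact: le_cover_outer.
by apply: ereal_sup_ubound; exists d.
Qed.

Lemma hausdorff_sigma_subadditive n : sigma_subadditive (hausdorff n).
Proof.
move=> F; apply: ge_ereal_sup => _ [d d0 <-].
apply: (@le_trans _ _ (\sum_(i <oo) hausdorff_delta n d (F i))).
  exact/cover_outer_sigma_subadditive/hausdorff_gauge_ge0.
apply: lee_nneseries => i *; first exact/cover_outer_ge0/hausdorff_gauge_ge0.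
by apply: ereal_sup_ubound; exists d.
Qed.

HB.instance Definition _ (n : nat) := isOuterMeasure.Build R 'rV[R]_N
  (hausdorff n) (hausdorff0 n) (hausdorff_ge0 n) (@le_hausdorff n)
  (@hausdorff_sigma_subadditive n).

Definition hausdorff_outer (n : nat) :
  {outer_measure set 'rV[R]_N -> \bar R} := hausdorff n.

(* R^N with the sigma-algebra of the (Caratheodory) H^n-measurable sets *)
Definition hausdorff_type (n : nat) := caratheodory_type (hausdorff_outer n).

Definition hausdorff_measure (n : nat) :
    {measure set (hausdorff_type n) -> \bar R} :=
  hausdorff_outer n : set (caratheodory_type (hausdorff_outer n)) -> \bar R.

End Hausdorff.

Arguments hausdorff_measure R N n : clear implicits.

Section Operators.
Context {R : realType} {N : nat}.
Implicit Types (C : nat -> R -> R) (s : R) (V : {vspace 'rV[R]_N}).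
Implicit Types (u : 'rV[R]_N -> R) (x : 'rV[R]_N).

Definition J_integrand s V u x (z : 'rV[R]_N) : R :=
  (u (x + z) - u x) / enorm z `^ ((\dim V)%:R + 2 * s).

Definition J_domain V (eps : R) : set 'rV[R]_N :=
  [set z | z \in V /\ eps <= enorm z].

Definition J_trunc s V u x (eps : R) : R :=
  \int[hausdorff_measure R N (\dim V)]_(z in J_domain V eps)
     J_integrand s V u x z.

Definition J_op C s V u x : R :=
  C (\dim V) s * lim (J_trunc s V u x eps @[eps --> 0^'+]).

(* the principal value exists and is a real number *)
Definition J_defined s V u x : Prop :=
  (forall eps, 0 < eps ->
    (hausdorff_measure R N (\dim V)).-integrable (J_domain V eps)
      (EFin \o J_integrand s V u x)) /\
  cvg (J_trunc s V u x eps @[eps --> 0^'+]).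

Context {l : nat}.
Implicit Types k : 'I_l -> nat.

Definition admissible k (W : 'I_l -> {vspace 'rV[R]_N}) : Prop :=
  (forall i, \dim (W i) = k i) /\
  (forall i j, i != j -> orthogonal_vs (W i) (W j)).

Definition Kplus_values C s k u x : set R :=
  [set \sum_(i < l) J_op C s (W i) u x | W in admissible k].

Definition Kplus C s k u x : R := sup (Kplus_values C s k u x).

(* The library's [lim] and [sup] are total, with junk values. *)
Definition Kplus_defined C s k u x : Prop :=
  (forall W, admissible k W -> forall i, J_defined s (W i) u x) /\
  has_sup (Kplus_values C s k u x).

(* L^oo(R^N) /\ C^2(Omega), H^N being Lebesgue measure on R^N *)
Definition Kplus_class (Omega : set 'rV[R]_N) u : Prop :=
  ((u : hausdorff_type N -> R) \in Lfun (hausdorff_measure R N N) +oo%E) /\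
  C2_on Omega u.

(* Indices are numbered from 0. *)
Definition A_block k (i : 'I_l) : {set 'I_N} :=
  [set m : 'I_N | (\sum_(j < l | (j < i)%N) k j <= m <
                   \sum_(j < l | (j <= i)%N) k j)%N].

Definition block_span k (i : 'I_l) : {vspace 'rV[R]_N} :=
  <<[seq ebasis m | m <- enum (A_block k i)]>>%VS.

Definition u_ex k x : R :=
  if (enorm x <= 1) || [exists i, x \in block_span k i] then 0 else -1.

End Operators.

(* Main.v *)
Require Import Defs.
From HB Require Import structures.
From mathcomp Require Import all_boot all_order all_algebra.
From mathcomp Require Import all_classical all_reals all_analysis.
From mathcomp Require Import measurable_realfun ess_sup_inf ring lra.

Set Implicit Arguments.
Unset Strict Implicit.
Unset Printing Implicit Defensive.

Import Order.TTheory GRing.Theory Num.Theory.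
Import numFieldNormedType.Exports.

Local Open Scope classical_set_scope.
Local Open Scope ring_scope.

(** The function [u] takes its maximum [0] at every point of the open unit ball,
    so every value of the operator there is at most [0]. At the origin the
    coordinate blocks themselves are an admissible family along which [u]
    vanishes, so the supremum is exactly [0] ([Kplus0]).

    Arbitrarily close to the origin there are points [x] lying in none of the
    blocks ([exists_off_blocks]). For such an [x] and any subspace [V], the
    affine space [x + V] meets a block in an affine space of dimension less than
    [\dim V], or not at all; hence [u (x + z) = -1] for almost every [z] in [V]
    with [2 <= |z|]. The contribution of [V] is then at most a negative constant
    that depends only on [\dim V] and [s], because a cube of [V] at distance at
    least [2] from the origin has Hausdorff measure bounded below uniformly in
    [V] ([J_trunc_jump], [Kplus_jump]). So the operator jumps at the origin.

    The measure theory behind this rests on an orthonormal basis of [V]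
    ([orthonormal_basis]), which makes [V] isometric to a Euclidean space:
    - Hausdorff measures add up on sets that a Lipschitz function separates, so
      Lipschitz functions are measurable by a criterion of Caratheodory
      ([additive_across_measurable]); balls and subspaces are sets defined by
      such functions;
    - covering a cube by small cells bounds its measure from above
      ([hausdorff_delta_flat_cube]); this makes lower dimensional affine spaces
      null ([hausdorff_affine_lt]) and the kernel [|z|^(-n-2s)] integrable away
      from the origin ([integral_tail_lty]);
    - counting grid points, after passing to a finite subcover, bounds the
      measure of a unit cube from below ([unit_cube_cover]).

    Near a point of the unit ball [u] is constant, so the integrand vanishes for
    small [z] and the principal values exist trivially
    ([J_trunc_stationary]). *)

(** * Euclidean geometry *)

Section EuclideanFacts.
Context {R : realType} {N : nat}.
Implicit Types (v w z : 'rV[R]_N) (a : R).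

Lemma edotE v w : edot v w = (v *m w^T) 0 0.
Proof. by rewrite mxE; apply: eq_bigr => m _; rewrite mxE. Qed.

Lemma edotC v w : edot v w = edot w v.
Proof. by apply: eq_bigr => m _; rewrite mulrC. Qed.

Lemma edotDl v w z : edot (v + w) z = edot v z + edot w z.
Proof. by rewrite !edotE mulmxDl mxE. Qed.

Lemma edotZl a v w : edot (a *: v) w = a * edot v w.
Proof. by rewrite !edotE -scalemxAl mxE. Qed.

Lemma edot_ge0 v : 0 <= edot v v.
Proof. by apply: sumr_ge0 => m _; rewrite -expr2 sqr_ge0. Qed.

Lemma edot_norm v : enorm v ^+ 2 = edot v v.
Proof. by rewrite sqr_sqrtr// edot_ge0. Qed.

Lemma enorm_ge0 v : 0 <= enorm v. Proof. exact: sqrtr_ge0. Qed.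

Lemma enorm0 : enorm (0 : 'rV[R]_N) = 0.
Proof. by rewrite /enorm edotE mul0mx mxE sqrtr0. Qed.

Lemma enorm_coord v i : `|v 0 i| <= enorm v.
Proof.
rewrite -(ler_sqr _ _) ?nnegrE ?normr_ge0 ?enorm_ge0//.
rewrite edot_norm real_normK ?num_real// expr2 /edot (bigD1 i)//= lerDl.
by apply: sumr_ge0 => m _; rewrite -expr2 sqr_ge0.
Qed.

Lemma enorm_eq0 v : enorm v = 0 -> v = 0.
Proof.
move=> v0; apply/rowP => i; rewrite mxE; apply/normr0_eq0/eqP.
by rewrite eq_le normr_ge0 andbT -v0 enorm_coord.
Qed.

(** Cauchy-Schwarz, by expanding the square of [(w.w) v - (v.w) w]. *)
Lemma edot_le v w : edot v w <= enorm v * enorm w.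
Proof.
have [w0|w0] := eqVneq (enorm w) 0.
  by rewrite (enorm_eq0 w0) enorm0 mulr0 edotC edotE mul0mx mxE.
have wgt0 : 0 < enorm w by rewrite lt_def w0 enorm_ge0.
apply: le_trans (ler_norm _) _.
rewrite -(ler_sqr _ _) ?nnegrE ?normr_ge0 ?mulr_ge0 ?enorm_ge0//.
rewrite real_normK ?num_real// exprMn !edot_norm.
have := edot_ge0 (edot w w *: v + (- edot v w) *: w).
rewrite edotDl !edotZl ![edot _ (_ + _)]edotC !edotDl !edotZl (edotC w v).
have : 0 < edot w w by rewrite -edot_norm exprn_gt0.
set a := edot v v; set b := edot v w; set c := edot w w => c0 H.
have : 0 <= c * (a * c - b ^+ 2).
  by apply: le_trans H _; rewrite le_eqVlt; apply/orP; left; apply/eqP; ring.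
by rewrite pmulr_rge0// subr_ge0.
Qed.

Lemma ler_enormD v w : enorm (v + w) <= enorm v + enorm w.
Proof.
rewrite -(ler_sqr _ _) ?nnegrE ?addr_ge0 ?enorm_ge0//.
rewrite edot_norm edotDl ![edot _ (_ + _)]edotC !edotDl (edotC w v).
have := edot_le v w; rewrite sqrrD !edot_norm; lra.
Qed.

Lemma edot_pythagoras v w : edot v w = 0 ->
  edot (v + w) (v + w) = edot v v + edot w w.
Proof.
move=> vw; rewrite edotDl ![edot _ (_ + _)]edotC !edotDl (edotC w v) vw.
by rewrite addr0 add0r.
Qed.

Lemma enormZ a v : enorm (a *: v) = `|a| * enorm v.
Proof.
rewrite /enorm edotZl edotC edotZl mulrA -expr2 sqrtrM ?sqr_ge0//.
by rewrite sqrtr_sqr.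
Qed.

Lemma enormN v : enorm (- v) = enorm v.
Proof. by rewrite -scaleN1r enormZ normrN normr1 mul1r. Qed.

Lemma enorm_distC v w : enorm (v - w) = enorm (w - v).
Proof. by rewrite -enormN opprB. Qed.

Lemma enorm_sum_coord v : enorm v <= \sum_i `|v 0 i|.
Proof.
rewrite -(ler_sqr _ _) ?nnegrE ?enorm_ge0 ?sumr_ge0// edot_norm.
rewrite expr2 mulr_suml ler_sum// => i _.
rewrite -[v 0 i * v 0 i]ger0_norm ?normrM -?expr2 ?sqr_ge0//.
rewrite expr2 ler_wpM2l// (bigD1 i)//= lerDl; exact: sumr_ge0.
Qed.

Lemma enorm_le_card v a : (forall i, `|v 0 i| <= a) -> enorm v <= N%:R * a.
Proof.
move=> va; apply: le_trans (enorm_sum_coord v) _.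
apply: (@le_trans _ _ (\sum_(i < N) a)); first exact: ler_sum.
by rewrite sumr_const card_ord mulr_natl.
Qed.

(** The topology of ['rV_N] is that of the sup norm, to which [enorm] is
    compared coordinatewise. *)
Lemma near_enorm v a : 0 < a -> \forall w \near v, enorm (w - v) < a.
Proof.
move=> a0.
have e0 : 0 < a / N.+1%:R by rewrite divr_gt0.
near=> w; apply: (@le_lt_trans _ _ (N%:R * (a / N.+1%:R))).
  have [_ vw] : ball v (a / N.+1%:R) w by near: w; exact: nbhsx_ballx.
  apply: enorm_le_card => i; rewrite !mxE distrC; exact/ltW/vw.
by rewrite mulrCA gtr_pMr// ltr_pdivrMr// mul1r ltr_nat.
Unshelve. all: by end_near. Qed.

End EuclideanFacts.

(** * Orthonormal bases of subspaces *)

Section Orthonormal.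
Context {R : realType} {N : nat}.
Implicit Types (V : {vspace 'rV[R]_N}).

Lemma dim_rV m : \dim {:'rV[R]_m} = m.
Proof. by rewrite dimvf; exact: mul1n. Qed.

(** Orthonormality is used through the isometry [c |-> c *m B]. *)
Definition orthonormal_rows m (B : 'M[R]_(m, N)) := B *m B^T = 1%:M.

Lemma edot_mulmx m (B : 'M[R]_(m, N)) (v w : 'rV_m) : orthonormal_rows B ->
  edot (v *m B) (w *m B) = edot v w.
Proof.
by move=> BB; rewrite !edotE trmx_mul mulmxA -(mulmxA v) BB mulmx1.
Qed.

Lemma enorm_mulmx m (B : 'M[R]_(m, N)) (v : 'rV_m) : orthonormal_rows B ->
  enorm (v *m B) = enorm v.
Proof. by move=> BB; rewrite /enorm edot_mulmx. Qed.

(** If every [z] in [V] were its own projection on the rows of [B], then [V]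
    would be an image of ['rV_m]; so some [z] leaves a nonzero residue, which is
    normalized and added as a row. *)
Lemma orthonormal_extend V m (B : 'M[R]_(m, N)) : orthonormal_rows B ->
  (forall c, c *m B \in V) -> (m < \dim V)%N ->
  exists B' : 'M[R]_(1 + m, N),
    orthonormal_rows B' /\ forall c, c *m B' \in V.
Proof.
move=> BB BV mV.
have [z zV zP] : exists2 z, z \in V & z - (z *m B^T) *m B != 0.
  apply: contrapT => Hn.
  suff : (\dim V <= m)%N by rewrite leqNgt mV.
  pose f : 'Hom('rV[R]_m, 'rV[R]_N) := linfun (mulmxr B).
  apply: (@leq_trans (\dim (limg f))).
    apply/dimvS/subvP => z zV.
    have -> : z = f (z *m B^T).
      rewrite lfunE /=; apply/eqP; rewrite -subr_eq0; apply/negP => zP.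
      by apply: Hn; exists z => //; apply/negP.
    exact/memv_img/memvf.
  have := limg_ker_dim f fullv; rewrite dim_rV => E.
  exact: leq_trans (leq_addl _ _) (eq_leq E).
set w := z - _ in zP.
have wB : w *m B^T = 0.
  by rewrite /w mulmxBl -(mulmxA (z *m B^T)) BB mulmx1 subrr.
have w0 : enorm w != 0 by apply: contra zP => /eqP/enorm_eq0 ->.
pose b := (enorm w)^-1 *: w.
have bB : b *m B^T = 0 by rewrite -scalemxAl wB scaler0.
have bb : b *m b^T = 1%:M.
  apply/rowP => i; rewrite ord1 -edotE mxE eqxx edotZl edotC edotZl -edot_norm.
  by rewrite expr2 mulKf// mulVf.
have bV : b \in V by rewrite memvZ// memvB.
exists (col_mx b B); split.
  rewrite /orthonormal_rows tr_col_mx mul_col_row bb BB bB.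
  have -> : B *m b^T = (b *m B^T)^T by rewrite trmx_mul trmxK.
  by rewrite bB trmx0 -scalar_mx_block.
move=> c; rewrite -(hsubmxK c) mul_row_col memvD//.
rewrite [lsubmx c]mx11_scalar mul_scalar_mx; exact: memvZ.
Qed.

(** Orthonormal families inside [V] are extended one row at a time, up to the
    dimension of [V]. *)
Lemma orthonormal_basis V : exists B : 'M[R]_(\dim V, N),
  orthonormal_rows B /\ forall z, z \in V <-> exists c, z = c *m B.
Proof.
have : forall m, (m <= \dim V)%N -> exists B : 'M[R]_(m, N),
    orthonormal_rows B /\ forall c, c *m B \in V.
  elim=> [_|m IH mV].
    exists 0; split; first by rewrite /orthonormal_rows; apply/matrixP => -[].
    by move=> c; rewrite mulmx0 mem0v.
  have [B [BB BV]] := IH (ltnW mV).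
  exact: orthonormal_extend BB BV mV.
move=> /(_ _ (leqnn _))[B [BB BV]]; exists B; split => // z.
pose f : 'Hom('rV[R]_(\dim V), 'rV[R]_N) := linfun (mulmxr B).
suff Vf : V = limg f.
  rewrite [in z \in V]Vf.
  split=> [/memv_imgP[c _ ->]|[c ->]]; first by exists c; rewrite lfunE.
  by have := memv_img f (memvf c); rewrite lfunE.
apply/esym/eqP; rewrite eqEdim; apply/andP; split.
  by apply/subvP => _ /memv_imgP[c _ ->]; rewrite lfunE; exact: BV.
rewrite limg_dim_eq ?dim_rV//.
apply/eqP; rewrite capfv; apply/lker0P => c d; rewrite !lfunE /=.
by move=> /(congr1 (mulmxr B^T)) /=; rewrite -!mulmxA BB !mulmx1.
Qed.

(** The residue of the orthogonal projection on [V] is 1-Lipschitz and vanishes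
    exactly on [V]; it presents [V] as a closed set. *)
Lemma vspace_lipschitz V : exists f : 'rV[R]_N -> R,
  [/\ forall x y, f x - f y <= enorm (x - y), forall x, 0 <= f x &
      forall z, z \in V <-> f z = 0].
Proof.
have [B [BB BV]] := orthonormal_basis V.
(* [P] is the projection on the orthogonal complement of [V]. *)
pose P (z : 'rV[R]_N) := z - (z *m B^T) *m B.
have PB x y : P (x - y) = P x - P y.
  by rewrite /P !mulmxBl !opprB addrACA [RHS]addrACA (addrC (- y)).
have Ple z : enorm (P z) <= enorm z.
  rewrite -(ler_sqr _ _) ?nnegrE ?enorm_ge0// !edot_norm.
  have PV : edot (P z) ((z *m B^T) *m B) = 0.
    rewrite edotE trmx_mul mulmxA mulmxBl -(mulmxA (z *m B^T)) BB mulmx1.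
    by rewrite subrr mul0mx mxE.
  rewrite -[in leRHS](subrK ((z *m B^T) *m B) z).
  by rewrite (edot_pythagoras PV) lerDl edot_ge0.
exists (enorm \o P); split => [x y|x|z] /=; last 2 first.
- exact: enorm_ge0.
- split=> [/BV[c ->]|/enorm_eq0/eqP].
    by rewrite /P -(mulmxA c) BB mulmx1 subrr enorm0.
  by rewrite subr_eq0 => /eqP zB; apply/BV; exists (z *m B^T).
rewrite lerBlDr; apply: le_trans _ (lerD (Ple _) (lexx _)).
by rewrite PB -{1}(subrK (P y) (P x)) ler_enormD.
Qed.

End Orthonormal.

(** * Measurability of Lipschitz functions *)

Section CaratheodoryCriterion.
Local Open Scope ereal_scope.
Context {R : realType} {T : pointedType}.
Variables (mu : {outer_measure set T -> \bar R}) (f : T -> R).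

(** The half of additivity that an outer measure lacks, for sets at a positive
    distance as measured by [f]. *)
Definition additive_across := forall (a b : R) (A B : set T), (a < b)%R ->
  (forall x, A x -> (f x <= a)%R) -> (forall x, B x -> (b <= f x)%R) ->
  mu A + mu B <= mu (A `|` B).

Hypothesis fmu : additive_across.

Variables (r : R) (X : set T).

(** [t] decreases to [r]; the layers [D n] lie between consecutive thresholds,
    and [E n] is the part of [X] above the threshold [t n]. *)
Let t (n : nat) : R := (r + n.+1%:R^-1)%R.
Let E (n : nat) := X `&` [set x | (t n <= f x)%R].
Let D (n : nat) := X `&` [set x | (t n.+2 <= f x < t n.+1)%R].

Let t_decr n : (t n.+1 < t n)%R.
Proof. by rewrite ltrD2l ltf_pV2 ?posrE// ltr_nat. Qed.

(** [D n] lies below [t n.+1] and [E n] above [t n], hence the gap. *)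
Let E_step n : mu (E n) + mu (D n) <= mu (E n.+2).
Proof.
rewrite addeC; apply: le_trans (fmu (a := t n.+1) (b := t n) _ _ _) _.
- exact: t_decr.
- by move=> x [_ /andP[_ /ltW]].
- by move=> x [].
apply: le_outer_measure => x [[Xx /andP[? _]]|[Xx tx]]; split => //=.
by apply: le_trans tx; rewrite ltW// (lt_trans (t_decr _)).
Qed.

(** Consecutive layers touch, so [E_step] only chains every second layer; adding
    the two parities gives the two terms on the right. *)
Let sum_layers n : \sum_(0 <= i < n) mu (D i) <= mu (E n) + mu (E n.+1).
Proof.
elim: n => [|n IH]; first by rewrite big_geq// adde_ge0// outer_measure_ge0.
rewrite big_nat_recr//=; apply: le_trans (leeD IH (lexx _)) _.
by rewrite addeAC addeC leeD2l.
Qed.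

(** The set [f > r] is exhausted by the sets [E n], which are separated from
    [f <= r], up to the tail of a convergent series of layers. *)
Lemma caratheodory_sublevel_le :
  mu (X `&` [set x | (f x <= r)%R]) + mu (X `&` ~` [set x | (f x <= r)%R]) <=
  mu X.
Proof.
have [->|Xoo] := eqVneq (mu X) +oo; first by rewrite leey.
have Xfin : mu X \is a fin_num by rewrite ge0_fin_numE ?outer_measure_ge0// ltey.
have sumD : \sum_(0 <= i <oo) mu (D i) < +oo.
  apply: (@le_lt_trans _ _ (mu X + mu X)); last by rewrite ltey_eq fin_numD Xfin.
  apply: lime_le; first by apply: is_cvg_nneseries => *; exact: outer_measure_ge0.
  near=> n; apply: le_trans (sum_layers n) _.
  by apply: leeD; apply: le_outer_measure => x [].
have := nneseries_tail_cvg sumD (fun k _ => outer_measure_ge0 mu (D k)).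
move=> /fine_cvgP[tfin tail0].
apply/lee_addgt0Pr => e e0.
near \oo => n.
have tl : \sum_(n <= k <oo) mu (D k) <= e%:E.
  have nf : \sum_(n <= k <oo) mu (D k) \is a fin_num by near: n.
  rewrite -(fineK nf) lee_fin; apply/ltW; near: n.
  move: tail0 => /cvgrPdist_lt/(_ e e0); apply: filterS => n /=.
  by rewrite sub0r normrN; exact: le_lt_trans (ler_norm _).
apply: le_trans (leeD (lexx (mu X)) tl).
apply: (@le_trans _ _ (mu (X `&` [set x | (f x <= r)%R]) +
    (mu (E n.+1) + mu (\bigcup_(k in ~` `I_n) D k)))).
  apply: leeD2l; apply: le_trans (outer_measureU2 _ _ _).
  apply: le_outer_measure => x [Xx /negP]; rewrite -ltNge => rx.
  have [tx|tx] := leP (t n.+1) (f x); first by left.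
  right.
  (* The first threshold below [f x] tells the layer of [x]. *)
  have ex : exists k, (t k.+1 <= f x)%R.
    exists (Num.bound (f x - r)^-1); rewrite /t -lerBrDl.
    rewrite -[leRHS]invrK lef_pV2 ?posrE ?invr_gt0 ?subr_gt0//.
    apply/ltW/(lt_trans (archi_boundP _)); first by rewrite invr_ge0 subr_ge0 ltW.
    by rewrite ltr_nat.
  case: (ex_minnP ex) => -[|k] tk kmin.
    by have := le_lt_trans tk tx; rewrite ltNge; case: (n) => [|m];
       rewrite /t lerD2l lef_pV2 ?posrE ?ler_nat.
  exists k.
    move=> /= kn; have := le_lt_trans tk tx.
    by rewrite ltrD2l ltf_pV2 ?posrE// ltr_nat !ltnS leqNgt kn.
  split => //=; rewrite tk ltNge; apply/negP => /kmin.
  by rewrite ltnn.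
rewrite addeA; apply: leeD; last exact: outer_measure_sigma_subadditive_tail.
apply: le_trans (fmu (a := r) (b := t n.+1) _ _ _) _.
- by rewrite ltrDl invr_gt0.
- by move=> x [].
- by move=> x [].
by apply: le_outer_measure => x [[]|[]].
Unshelve. all: by end_near. Qed.

End CaratheodoryCriterion.

Lemma additive_across_measurable {R : realType} {T : pointedType}
    (mu : {outer_measure set T -> \bar R}) (f : T -> R) :
  additive_across mu f ->
  measurable_fun setT (f : caratheodory_type mu -> R).
Proof.
move=> fmu; apply: (measurability _ (RGenOInfty.measurableE R)).
move=> _ [_ [r ->] <-]; rewrite setTI.
have -> : f @^-1` `]r, +oo[%classic = ~` [set x | f x <= r].
  by apply/seteqP; split=> x /=; rewrite in_itv/= andbT ltNge => /negP.
apply: caratheodory_measurable_setC; apply: le_caratheodory_measurable => X.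
exact: caratheodory_sublevel_le.
Qed.

Section HausdorffMetric.
Local Open Scope ereal_scope.
Context {R : realType} {N : nat}.
Implicit Types (A B U : set 'rV[R]_N) (n : nat).

Definition lipschitz1 (f : 'rV[R]_N -> R) :=
  forall x y, (f x - f y <= enorm (x - y))%R.

Lemma ediam_ge U x y : U x -> U y -> (enorm (x - y))%:E <= ediam U.
Proof. by move=> Ux Uy; apply: ereal_sup_ubound; exists (x, y). Qed.

(** A set of small diameter cannot meet both [A] and [B], so a fine cover of
    the union splits into a cover of [A] and a cover of [B]. *)
Lemma hausdorff_delta_across n (f : 'rV[R]_N -> R) (a b d : R) A B :
  lipschitz1 f -> (d < b - a)%R ->
  (forall x, A x -> (f x <= a)%R) -> (forall x, B x -> (b <= f x)%R) ->
  hausdorff_delta n d A + hausdorff_delta n d B <= hausdorff_delta n d (A `|` B).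
Proof.
move=> fL dab Aa Bb; apply: le_ereal_inf_tmp => _ [F [FP ABF] <-].
pose sel (C : set 'rV[R]_N) i := if F i `&` C == set0 then set0 else F i.
have selP C i : ediam (sel C i) <= d%:E.
  by rewrite /sel; case: ifP => _; [exact: ediam_set0_le|exact: FP].
have selC C : C `<=` A `|` B -> hausdorff_delta n d C <=
    \sum_(i <oo) hausdorff_gauge n (sel C i).
  move=> CAB; apply: ereal_inf_lbound; exists (sel C) => //.
  split=> [i|x Cx]; first exact: selP.
  have [i _ Fx] := ABF x (CAB _ Cx); exists i => //; rewrite /sel ifF//.
  by apply/negbTE/set0P; exists x.
apply: le_trans (leeD (selC A _) (selC B _)) _;
  [exact: subsetUl|exact: subsetUr|].
rewrite -nneseriesD; try by move=> *; exact: hausdorff_gauge_ge0.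
apply: lee_nneseries => [*|i _].
  by rewrite adde_ge0// hausdorff_gauge_ge0.
rewrite /sel; case: ifPn => [_|/set0P[x [Fx Ax]]].
  rewrite hausdorff_gauge0 add0e; case: ifP => // _.
  by rewrite hausdorff_gauge0 hausdorff_gauge_ge0.
case: ifPn => [_|/set0P[y [Fy By]]]; first by rewrite hausdorff_gauge0 adde0.
exfalso; have := le_trans (ediam_ge Fy Fx) (FP i); rewrite lee_fin.
have := fL y x; have := Aa _ Ax; have := Bb _ By; move: dab; lra.
Qed.

Lemma le_hausdorff_delta n (d d' : R) A : (d <= d')%R ->
  hausdorff_delta n d' A <= hausdorff_delta n d A.
Proof.
move=> dd; apply: ereal_inf_le_tmp => _ [F [FP AF] <-]; exists F => //.
by split=> [i|//]; apply: le_trans (FP i) _; rewrite lee_fin.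
Qed.

Lemma hausdorff_delta_le n (d : R) A : (0 < d)%R ->
  hausdorff_delta n d A <= hausdorff n A.
Proof. by move=> d0; apply: ereal_sup_ubound; exists d. Qed.

Lemma hausdorff_additive_across n (f : 'rV[R]_N -> R) : lipschitz1 f ->
  additive_across (hausdorff_outer n) f.
Proof.
move=> fL a b A B ab Aa Bb.
change (hausdorff n A + hausdorff n B <= hausdorff n (A `|` B)).
have [->|Soo] := eqVneq (hausdorff n (A `|` B)) +oo; first by rewrite leey.
have fin C : C `<=` A `|` B -> hausdorff n C \is a fin_num.
  move=> CAB; rewrite ge0_fin_numE ?hausdorff_ge0//.
  by apply: le_lt_trans (le_hausdorff n CAB) _; rewrite ltey.
have Afin := fin A (@subsetUl _ A B); have Bfin := fin B (@subsetUr _ A B).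
rewrite -leeBrDr//; apply: ge_ereal_sup => _ [d1 /= d10 <-].
have fin1 : hausdorff_delta n d1 A \is a fin_num.
  rewrite ge0_fin_numE; last exact/cover_outer_ge0/hausdorff_gauge_ge0.
  by apply: le_lt_trans (hausdorff_delta_le n A d10) _; rewrite ltey_eq Afin.
rewrite leeBrDr// addeC -leeBrDr//; apply: ge_ereal_sup => _ [d2 /= d20 <-].
rewrite leeBrDr//.
(* Both terms increase when the mesh is refined below [(b - a) / 2]. *)
pose d : R := Num.min (Num.min d1 d2) ((b - a) / 2)%R.
have d0 : (0 < d)%R by rewrite !lt_min d10 d20 divr_gt0// subr_gt0.
apply: le_trans (hausdorff_delta_le n _ d0).
apply: le_trans (hausdorff_delta_across n fL (_ : d < b - a)%R Aa Bb).
  by rewrite addeC; apply: leeD; apply: le_hausdorff_delta;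
     rewrite !ge_min lexx ?orbT.
apply: (@le_lt_trans _ _ ((b - a) / 2)%R); first by rewrite ge_min lexx orbT.
by rewrite ltr_pdivrMr// ltr_pMr ?subr_gt0// ltr1n.
Qed.

Lemma lipschitz1_measurable n (f : 'rV[R]_N -> R) : lipschitz1 f ->
  measurable_fun setT (f : @hausdorff_type R N n -> R).
Proof.
by move=> fL; exact/additive_across_measurable/hausdorff_additive_across.
Qed.

End HausdorffMetric.

(** * Upper bounds for Hausdorff measures *)

Section HausdorffUpperBound.
Local Open Scope ereal_scope.
Context {R : realType} {N : nat}.
Implicit Types (A U : set 'rV[R]_N) (n m : nat).

Lemma hausdorff_delta_finite (I : finType) n (d : R) A (G : I -> set 'rV[R]_N) :
  (forall i, ediam (G i) <= d%:E) -> A `<=` \bigcup_i G i ->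
  hausdorff_delta n d A <= \sum_(i : I) hausdorff_gauge n (G i).
Proof.
move=> Gd AG.
pose F k := if insub k is Some j then G (enum_val (j : 'I_#|I|)) else set0.
apply: (@le_trans _ _ (\sum_(k <oo) hausdorff_gauge n (F k))).
  apply: ereal_inf_lbound; exists F => //; split=> [k|x /AG[i _ Gx]].
    rewrite /F; case: insubP => [j _ _|_]; [exact: Gd|exact: ediam_set0_le].
  exists (enum_rank i) => //; rewrite /F insubT//= => ltI.
  by rewrite (_ : Sub _ _ = enum_rank i) ?enum_rankK//; exact: val_inj.
rewrite (nneseries_split _ #|I|); last by move=> *; exact: hausdorff_gauge_ge0.
rewrite [X in _ + X]eseries0 ?adde0; last first.
  move=> k Ik _; rewrite /F; case: insubP => [j|_]; last exact: hausdorff_gauge0.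
  by rewrite add0n in Ik; rewrite ltnNge Ik.
rewrite big_mkord.
under eq_bigr => j _ do rewrite /F valK.
by rewrite -(big_enum_val (fun i => hausdorff_gauge n (G i))).
Qed.

Lemma hausdorff_gauge_le n U (e : R) : ediam U <= e%:E ->
  hausdorff_gauge n U <= (unit_ball_volume n / 2 ^+ n * `|e| ^+ n)%:E.
Proof.
move=> Ue; have w0 : (0 <= unit_ball_volume n / 2 ^+ n :> R)%R.
  by rewrite divr_ge0 ?unit_ball_volume_ge0.
rewrite /hausdorff_gauge; case: ifPn => [_|/set0P[v Uv]].
  by rewrite lee_fin mulr_ge0// exprn_ge0.
have := ediam_ge Uv Uv; rewrite subrr enorm0.
case: (ediam U) Ue => [r||] //; rewrite !lee_fin => re r0.
rewrite -EFin_expe lee_fin ler_wpM2l// lerXn2r ?nnegrE//.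
exact: le_trans re (ler_norm _).
Qed.

(** The cube is open so that every coordinate falls into one of exactly [M]
    half-open cells. *)
Definition flat_cube m (B : 'M[R]_(m, N)) (a : 'rV[R]_N) (rho : R) :
  set 'rV[R]_N := [set z | exists2 c : 'rV_m,
    z = (a + c *m B)%R & forall i, (`|c 0%R i| < rho)%R].

(** The cube is covered by [M ^ m] cells of side [2 rho / M]. *)
Lemma hausdorff_delta_flat_cube n m (B : 'M[R]_(m, N)) a (rho d : R) (M : nat) :
  orthonormal_rows B -> (0 < rho)%R -> (0 < M)%N ->
  (m%:R * (2 * rho / M%:R) <= d)%R ->
  hausdorff_delta n d (flat_cube B a rho) <=
  (M%:R ^+ m * (unit_ball_volume n / 2 ^+ n * (m%:R * (2 * rho / M%:R)) ^+ n))%:E.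
Proof.
move=> BB rho0 M0 Md; set h : R := (2 * rho / M%:R)%R in Md *.
have h0 : (0 < h)%R by rewrite divr_gt0 ?mulr_gt0 ?ltr0n.
pose G (j : {ffun 'I_m -> 'I_M}) : set 'rV[R]_N :=
  [set z | exists2 c : 'rV_m, z = (a + c *m B)%R &
    forall i, ((j i)%:R * h <= c 0%R i + rho < (j i).+1%:R * h)%R].
have Gd j : ediam (G j) <= (m%:R * h)%:E.
  apply: ge_ereal_sup => _ [[_ _] [/= [c -> cj] [c' -> cj']] <-] /=.
  rewrite lee_fin opprD addrACA subrr add0r -mulmxBl enorm_mulmx//.
  apply: enorm_le_card => i; rewrite !mxE ler_norml.
  move: (cj i) (cj' i); rewrite -natr1 mulrDl mul1r; set y := (_ * h)%R; lra.
apply: le_trans (@hausdorff_delta_finite _ n d _ G _ _) _.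
- by move=> j; apply: le_trans (Gd j) _; rewrite lee_fin.
- move=> _ [c -> crho].
  have c0 i : (0 <= (c 0%R i + rho) / h)%R.
    by rewrite divr_ge0 ?(ltW h0)//; have := crho i; rewrite ltr_norml; lra.
  have cM i : (Num.trunc ((c 0%R i + rho) / h) < M)%N.
    have /andP[tc _] := truncn_itv (c0 i).
    rewrite -(ltr_nat R); apply: le_lt_trans tc _; rewrite ltr_pdivrMr//.
    rewrite /h mulrCA divff ?pnatr_eq0 -?lt0n// mulr1.
    by have := crho i; rewrite ltr_norml; lra.
  exists [ffun i => Ordinal (cM i)] => //; exists c => // i; rewrite ffunE /=.
  by rewrite -ler_pdivlMr// -ltr_pdivrMr//; exact: truncn_itv.
apply: (@le_trans _ _ (\sum_(j : {ffun 'I_m -> 'I_M})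
    (unit_ball_volume n / 2 ^+ n * (m%:R * h) ^+ n)%:E)).
  apply: lee_sum => j _; apply: le_trans (hausdorff_gauge_le n (Gd j)) _.
  by rewrite ger0_norm// mulr_ge0// ltW.
rewrite sumEFin lee_fin sumr_const card_ffun !card_ord.
by rewrite -[leLHS]mulr_natl natrX.
Qed.

Lemma fine_mesh (r e : R) : (0 <= r)%R -> (0 < e)%R ->
  exists2 M : nat, (0 < M)%N & (r / M%:R <= e)%R.
Proof.
move=> r0 e0; exists (Num.bound (r / e)).+1 => //.
rewrite ler_pdivrMr ?ltr0n// mulrC -ler_pdivrMr//.
apply/ltW/(lt_trans (archi_boundP _)); first by rewrite divr_ge0// ltW.
by rewrite ltr_nat.
Qed.

Lemma hausdorff_flat_cube n (B : 'M[R]_(n, N)) a (rho : R) :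
  orthonormal_rows B -> (0 < rho)%R ->
  hausdorff n (flat_cube B a rho) <=
  (unit_ball_volume n / 2 ^+ n * (2 * n%:R) ^+ n * rho ^+ n)%:E.
Proof.
move=> BB rho0; apply: ge_ereal_sup => _ [d /= d0 <-].
have r0 : (0 <= n%:R * (2 * rho))%R by rewrite mulr_ge0// mulr_ge0// ltW.
have [M M0 Md] := fine_mesh r0 d0.
apply: le_trans (hausdorff_delta_flat_cube n a BB rho0 M0 _) _.
  by rewrite mulrA.
rewrite lee_fin le_eqVlt; apply/orP; left; apply/eqP.
have MM : (M%:R ^+ n != 0 :> R)%R by rewrite expf_neq0// pnatr_eq0 -lt0n.
rewrite !exprMn exprVn; set w := (_ / _)%R; set M' := (M%:R ^+ n)%R in MM *.
by field.
Qed.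

(** The number of cells grows like [M ^ m] while the gauge of each decays like
    [M ^- n]. *)
Lemma hausdorff_flat_cube_lt n m (B : 'M[R]_(m, N)) a (rho : R) :
  orthonormal_rows B -> (0 < rho)%R -> (m < n)%N ->
  hausdorff n (flat_cube B a rho) = 0.
Proof.
move=> BB rho0 mn; apply/eqP; rewrite eq_le hausdorff_ge0 andbT.
apply: ge_ereal_sup => _ [d /= d0 <-].
pose K : R := (unit_ball_volume n / 2 ^+ n * (m%:R * (2 * rho)) ^+ n)%R.
have K0 : (0 <= K)%R.
  rewrite mulr_ge0 ?divr_ge0 ?unit_ball_volume_ge0// exprn_ge0//.
  by rewrite !mulr_ge0// ltW.
apply/lee_addgt0Pr => e e0; rewrite add0e.
have r0 : (0 <= m%:R * (2 * rho) / d + K / e)%R.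
  by apply: addr_ge0; apply: divr_ge0; rewrite ?(ltW d0) ?(ltW e0)//;
     rewrite !mulr_ge0// ltW.
(* [M] makes the cells smaller than [d] and their total gauge at most [e]. *)
have [M M0 Me] := fine_mesh r0 ltr01.
have MR : (0 < M%:R :> R)%R by rewrite ltr0n.
move: Me; rewrite ler_pdivrMr// mul1r => Me.
have M1 : (m%:R * (2 * rho) <= d * M%:R)%R.
  rewrite -ler_pdivrMl// [leLHS]mulrC; apply: le_trans Me; rewrite lerDl.
  by rewrite divr_ge0// ltW.
have M2 : (K <= e * M%:R)%R.
  rewrite -ler_pdivrMl// [leLHS]mulrC; apply: le_trans Me; rewrite lerDr.
  by rewrite divr_ge0 ?(ltW d0)// !mulr_ge0// ltW.
apply: le_trans (hausdorff_delta_flat_cube n a BB rho0 M0 _) _.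
  by rewrite mulrA ler_pdivrMr.
rewrite lee_fin (mulrA m%:R) expr_div_n (mulrA (_ / _)%R) -/K mulrA.
rewrite ler_pdivrMr ?exprn_gt0//.
apply: (@le_trans _ _ (M%:R ^+ m * (e * M%:R))%R).
  by rewrite ler_wpM2l// exprn_ge0.
rewrite mulrCA -exprSr ler_wpM2l ?(ltW e0)// ler_weXn2l//.
by rewrite ler1n.
Qed.

(** The total gauge, in units of [rho ^ n], of the cells covering the cube; the
    crude diameter bound [n] times the side makes it exceed the volume. *)
Definition ball_const n : R :=
  (unit_ball_volume n / 2 ^+ n * (2 * n%:R) ^+ n)%R.

Lemma ball_const_ge0 n : (0 <= ball_const n)%R.
Proof.
by rewrite mulr_ge0 ?divr_ge0 ?unit_ball_volume_ge0// exprn_ge0// mulr_ge0.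
Qed.

Lemma hausdorff_vspace_ball (V : {vspace 'rV[R]_N}) (rho : R) : (0 < rho)%R ->
  hausdorff (\dim V) [set z | z \in V /\ (enorm z < rho)%R] <=
  (ball_const (\dim V) * rho ^+ \dim V)%:E.
Proof.
move=> rho0; have [B [BB BV]] := orthonormal_basis V.
apply: le_trans (hausdorff_flat_cube 0 BB rho0).
apply: le_hausdorff => z [/BV[c ->]]; rewrite enorm_mulmx// => crho.
exists c; first by rewrite add0r.
by move=> i; apply: le_lt_trans crho; exact: enorm_coord.
Qed.

Lemma hausdorff_affine_lt (W : {vspace 'rV[R]_N}) (a : 'rV[R]_N) n :
  (\dim W < n)%N ->
  hausdorff n [set z | (z - a)%R \in W] = 0.
Proof.
move=> Wn; have [B [BB BW]] := orthonormal_basis W.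
apply/eqP; rewrite eq_le hausdorff_ge0 andbT.
apply: (@le_trans _ _ (hausdorff n (\bigcup_k flat_cube B a k.+1%:R))).
  apply: le_hausdorff => z /= /BW[c zc].
  exists (Num.bound (enorm c)) => //; exists c; first by rewrite -zc addrC subrK.
  move=> i; apply: le_lt_trans (enorm_coord _ _) _.
  by apply: lt_trans (archi_boundP (enorm_ge0 _)) _; rewrite ltr_nat.
apply: le_trans (hausdorff_sigma_subadditive n _) _.
by rewrite eseries0// => k _ _; apply: hausdorff_flat_cube_lt.
Qed.

End HausdorffUpperBound.

(** * Lower bound for Hausdorff measures *)

(** Reducing the coordinates modulo [L + 1] is injective on a set of grid points
    whose coordinates differ by at most [L]. *)
Lemma card_grid_diam (n M L : nat) (S : {set {ffun 'I_n -> 'I_M}}) :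
  (forall j j', j \in S -> j' \in S -> forall a, (j a <= j' a + L)%N) ->
  (#|S| <= L.+1 ^ n)%N.
Proof.
move=> SL; pose th (j : {ffun 'I_n -> 'I_M}) : {ffun 'I_n -> 'I_L.+1} :=
  [ffun a => inord (j a %% L.+1)].
rewrite -[n in (_ ^ n)%N]card_ord -[L.+1]card_ord -card_ffun.
rewrite -(card_in_imset (f := th)) ?max_card// => j j' jS j'S.
move=> /ffunP tj; apply/ffunP => a; apply/val_inj.
have /(congr1 (@nat_of_ord _)) := tj a; rewrite !ffunE !inordK ?ltn_pmod//.
wlog le_j : j j' jS j'S {tj} / (j' a <= j a)%N.
  by move=> H; case/orP: (leq_total (j a) (j' a)) => ? E;
     [apply/esym/H|apply: H].
move/eqP; rewrite eqn_mod_dvd// => /dvdnP[q jq].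
have := SL _ _ jS j'S a; rewrite -leq_subLR jq.
case: q jq => [|q] jq; last by rewrite leqNgt mulSn leq_addr.
by move=> _; apply/eqP; rewrite eqn_leq le_j -subn_eq0 jq.
Qed.

Lemma sum_half_pow {R : realType} (K : nat) :
  \sum_(i < K) (2^-1 : R) ^+ i <= 2.
Proof.
suff -> : \sum_(i < K) (2^-1 : R) ^+ i = 2 - 2 * 2^-1 ^+ K.
  by rewrite gerBl mulr_ge0.
elim: K => [|K IH]; first by rewrite big_ord0 expr0; ring.
by rewrite big_ord_recr/= IH exprSr; field.
Qed.

(** A unit cube has measure 1; the factors [2^-n] and [1/2] are lost when
    [(d + 3 e)^n] is compared with [d^n]. *)
Definition cube_const {R : realType} (n : nat) : R :=
  unit_ball_volume n / 2 ^+ n * (2^-1 ^+ n / 2).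

Section HausdorffLowerBound.
Context {R : realType} {N n : nat}.
Variable B : 'M[R]_(n, N).
Hypothesis BB : orthonormal_rows B.

(** The coordinates are at least 2 in order that the cube avoid the ball of
    radius 2. *)
Definition unit_cube : set 'rV[R]_N :=
  [set z | exists2 c : 'rV_n, z = c *m B & forall i, 2 <= c 0 i <= 3].

(** A finite subcover by the [e i]-neighborhoods of the [F i] is compared with a
    fine grid: the grid has [M ^ n] points in the cube, and the [i]-th
    neighborhood contains at most [(M (d i + 3 e i)) ^ n] of them. *)
Lemma unit_cube_cover (F : nat -> set 'rV[R]_N) (d e : nat -> R) :
  unit_cube `<=` \bigcup_i F i ->
  (forall i x y, F i x -> F i y -> enorm (x - y) <= d i) ->
  (forall i, 0 <= d i) -> (forall i, 0 < e i) ->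
  exists K, 1 <= \sum_(i < K) (d i + 3 * e i) ^+ n.
Proof.
move=> QF Fd d0 e0.
pose U i : set 'rV[R]_n := [set c | exists2 w, F i w & enorm (c *m B - w) < e i].
have Uop i : open (U i).
  rewrite openE => c [w Fw cw].
  apply: filterS (near_enorm c (_ : 0 < e i - enorm (c *m B - w))).
    move=> c' c'c; exists w => //.
    rewrite (_ : c' *m B - w = (c' - c) *m B + (c *m B - w)); last first.
      by rewrite mulmxBl addrA subrK.
    apply: le_lt_trans (ler_enormD _ _) _; rewrite enorm_mulmx//.
    by rewrite -ltrBrDr.
  by rewrite subr_gt0.
pose Q : set 'rV[R]_n := [set c | forall i, `[2, 3]%classic (c ord0 i)].
have cQ : compact Q.
  by apply: (@rV_compact R n (fun=> `[2, 3]%classic)) => i; exact: segment_compact.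
have [D _ QD] : finite_subset_cover setT U Q.
  move: cQ; rewrite compact_cover; apply => // c Qc.
  have [|i _ Fi] := QF (c *m B).
    by exists c => // i; have := Qc i; rewrite /= in_itv.
  by exists i => //; exists (c *m B) => //; rewrite subrr enorm0.
pose K := (\max_(i <- finmap.enum_fset D) i).+1.
have QK c : Q c -> exists i : 'I_K, U i c.
  move=> /QD[i /= iD Ui].
  have iK : (i < K)%N by rewrite ltnS; exact: (leq_bigmax_seq i iD).
  by exists (Ordinal iK).
exists K.
(* The grid is so fine that [1 / M <= e i] for each [i < K]. *)
pose M := (Num.bound (\sum_(i < K) (e i)^-1)).+1.
have M0 : 0 < M%:R :> R by rewrite ltr0n.
have Me (i : 'I_K) : 1 <= M%:R * e i.
  rewrite -ler_pdivrMr// div1r; apply: (@le_trans _ _ (\sum_(i < K) (e i)^-1)).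
    by rewrite (bigD1 i)//= lerDl sumr_ge0// => k _; rewrite invr_ge0 ltW.
  apply/ltW/(lt_trans (archi_boundP _)); last by rewrite ltr_nat.
  by rewrite sumr_ge0// => k _; rewrite invr_ge0 ltW.
pose p (j : {ffun 'I_n -> 'I_M}) : 'rV[R]_n := \row_a (2 + (j a)%:R / M%:R).
pose S (i : 'I_K) : {set {ffun 'I_n -> 'I_M}} := [set j | `[< U i (p j) >]]%SET.
have pQ j : exists i, j \in S i.
  have [|i Ui] := QK (p j); last by exists i; rewrite inE; apply/asboolP.
  move=> a; rewrite /= in_itv/= mxE lerDl divr_ge0//=.
  rewrite -lerBrDl (_ : 3 - 2 = 1); last by ring.
  by rewrite ler_pdivrMr// mul1r ler_nat ltnW.
have cardS i : #|S i|%:R <= (M%:R * (d i + 3 * e i)) ^+ n.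
  have de0 : 0 <= M%:R * (d i + 2 * e i).
    by rewrite mulr_ge0// addr_ge0// mulr_ge0// ltW.
  have /andP[tl tu] := truncn_itv de0.
  set L := Num.trunc _ in tl tu.
  apply: (@le_trans _ _ (L.+1%:R ^+ n)).
    rewrite -natrX ler_nat; apply: card_grid_diam => j j' jS j'S a.
    move: jS j'S; rewrite !inE => -[w Fw jw] [w' Fw' jw'].
    have : enorm (p j - p j') <= d i + 2 * e i.
      rewrite -(enorm_mulmx _ BB) mulmxBl.
      rewrite (_ : p j *m B - p j' *m B =
        (p j *m B - w) + ((w - w') + (w' - p j' *m B))); last first.
        by rewrite !subrKA.
      apply: le_trans (ler_enormD _ _) _; rewrite addrC.
      apply: le_trans (lerD (ler_enormD _ _) (lexx _)) _.
      move: (Fd _ _ _ Fw Fw') jw jw'; rewrite (enorm_distC (p j' *m B)).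
      move: (enorm _) (enorm _) (enorm _) => x y z; lra.
    move=> /(le_trans (enorm_coord _ a)); rewrite !mxE.
    rewrite opprD addrACA subrr add0r -mulrBl.
    move=> /(le_trans (ler_norm _)); rewrite ler_pdivrMr// mulrC => jj.
    have := le_lt_trans jj tu; rewrite ltrBlDr -natrD ltr_nat addSn ltnS addnC.
    by [].
  apply: lerXn2r; rewrite ?nnegrE ?ler0n//.
    by rewrite mulr_ge0// addr_ge0// mulr_ge0// ltW.
  by rewrite -natr1; have := Me i; move: tl; nra.
have : (M ^ n)%:R <= \sum_(i < K) (#|S i|%:R : R).
  rewrite -natr_sum ler_nat -[n in (_ ^ n)%N]card_ord -[M in (M ^ _)%N]card_ord.
  rewrite -card_ffun -sum1_card.
  under [leqRHS]eq_bigr => i _ do rewrite -sum1_card big_mkcond.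
  rewrite exchange_big/=; apply: leq_sum => j _.
  by have [i ij] := pQ j; rewrite (bigD1 i)//= ij.
move=> /le_trans/(_ (ler_sum _ (fun i _ => cardS i))).
under eq_bigr => i _ do rewrite exprMn.
by rewrite -mulr_sumr natrX -[leLHS]mulr1 ler_pM2l ?exprn_gt0.
Qed.

Lemma unit_cube_hausdorff : (0 < n)%N ->
  ((cube_const n)%:E <= hausdorff n unit_cube)%E.
Proof.
move=> n0; apply: le_trans (hausdorff_delta_le n _ ltr01).
apply: le_ereal_inf_tmp => _ [F [FP QF] <-].
pose d i : R := if F i == set0 then 0 else fine (ediam (F i)).
have dE i x : F i x -> ediam (F i) = (d i)%:E.
  move=> Fx; rewrite /d ifF; last by apply/negbTE/set0P; exists x.
  have := ediam_ge Fx Fx; have := FP i; rewrite /=.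
  by case: (ediam (F i)).
have d0 i : 0 <= d i.
  rewrite /d; case: ifPn => // /set0P[x Fx].
  apply: fine_ge0; apply: le_trans (ediam_ge Fx Fx).
  by rewrite lee_fin enorm_ge0.
(* The enlargements [3 e i] sum to at most [2^-n / 2], half of what the cover
   must provide. *)
pose e i : R := 2^-1 ^+ n * 2^-1 ^+ i / 12.
have h0 k : 0 < (2^-1 : R) ^+ k by rewrite exprn_gt0.
have h1 k : (2^-1 : R) ^+ k <= 1 by rewrite exprn_ile1// invf_le1 ?ler1n.
have e0 i : 0 < e i by rewrite divr_gt0// mulr_gt0.
have e1 i : 3 * e i <= 1.
  by rewrite /e; have := h1 n; have := h1 i; have := h0 n; have := h0 i; nra.
have [|K HK] := unit_cube_cover QF _ d0 e0.
  by move=> i x y Fx Fy; rewrite -lee_fin -(dE i x Fx); exact: ediam_ge.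
have split_pow i : (d i + 3 * e i) ^+ n <= 2 ^+ n * (d i ^+ n + 3 * e i).
  have e3 : 0 <= 3 * e i by rewrite mulr_ge0// ltW.
  have ee : (3 * e i) ^+ n <= 3 * e i.
    by rewrite -[leRHS]expr1 ler_wiXn2l.
  (* A sum is at most twice its larger term. *)
  have [de|ed] := leP (d i) (3 * e i).
    apply: (@le_trans _ _ ((2 * (3 * e i)) ^+ n)).
      by apply: lerXn2r; rewrite ?nnegrE ?addr_ge0 ?mulr_ge0//; lra.
    by rewrite exprMn ler_wpM2l ?exprn_ge0// (le_trans ee)// lerDr exprn_ge0.
  apply: (@le_trans _ _ ((2 * d i) ^+ n)).
    by apply: lerXn2r; rewrite ?nnegrE ?addr_ge0 ?mulr_ge0//; lra.
  by rewrite exprMn ler_wpM2l ?exprn_ge0// lerDl.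
have Kd : 2^-1 ^+ n / 2 <= \sum_(i < K) d i ^+ n.
  have {HK} := le_trans HK (ler_sum _ (fun (i : 'I_K) _ => split_pow i)).
  rewrite -mulr_sumr big_split/= -!mulr_sumr -mulr_suml -mulr_sumr.
  have := sum_half_pow K (R := R); have := h0 n.
  have hh : (2^-1 : R) ^+ n * 2 ^+ n = 1 by rewrite -exprMn mulVf// expr1n.
  set D := \sum_(i < K) d i ^+ n; set G := \sum_(i < K) _; set h := _ ^+ n in hh *.
  set t := 2 ^+ n in hh * => hp G2 H.
  have : h * 1 <= h * (t * (D + 3 * (h * G / 12))) by rewrite ler_pM2l.
  by rewrite mulrA hh; nra.
have gd i :
    ((unit_ball_volume n / 2 ^+ n * d i ^+ n)%:E <= hausdorff_gauge n (F i))%E.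
  rewrite /hausdorff_gauge; case: ifPn => [/eqP F0|/set0P[x Fx]].
    by rewrite /d F0 eqxx expr0n gtn_eqF// mulr0.
  by rewrite (dE _ _ Fx) -EFin_expe.
apply: (@le_trans _ _ (\sum_(0 <= i < K) hausdorff_gauge n (F i))%E).
  rewrite big_mkord; apply: (@le_trans _ _ (\sum_(i < K)
    (unit_ball_volume n / 2 ^+ n * d i ^+ n)%:E)%E); last exact: lee_sum.
  rewrite sumEFin lee_fin -mulr_sumr ler_wpM2l//.
  by rewrite divr_ge0// unit_ball_volume_ge0.
by apply: nneseries_lim_ge => i *; exact: hausdorff_gauge_ge0.
Qed.

End HausdorffLowerBound.

Lemma unit_ball_volume_gt0 {R : realType} n : 0 < unit_ball_volume n :> R.
Proof.
suff : 0 < unit_ball_volume n :> R /\ 0 < unit_ball_volume n.+1 :> R by case.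
elim: n => [|n [IH1 IH2]] //; split => //=.
by rewrite mulr_gt0// divr_gt0// mulr_gt0// pi_gt0.
Qed.

Lemma cube_const_gt0 {R : realType} n : 0 < cube_const n :> R.
Proof.
rewrite /cube_const mulr_gt0// divr_gt0// ?exprn_gt0//.
exact: unit_ball_volume_gt0.
Qed.

(** * Integrability of the kernel *)

Section HausdorffMeasurable.
Context {R : realType} {N : nat} (n : nat).
Local Notation HT := (@hausdorff_type R N n).
Implicit Types (V : {vspace 'rV[R]_N}) (x : 'rV[R]_N).

Lemma enorm_lipschitz1 : lipschitz1 (@enorm R N).
Proof. by move=> x y; rewrite lerBlDr -{1}(subrK y x) ler_enormD. Qed.

Lemma lipschitz1_shift (f : 'rV[R]_N -> R) x : lipschitz1 f ->
  lipschitz1 (fun z => f (x + z)).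
Proof.
move=> fL y z; apply: le_trans (fL _ _) _.
by rewrite opprD addrACA subrr add0r.
Qed.

Lemma measurable_enorm_shift x :
  measurable_fun setT ((fun z => enorm (x + z)) : HT -> R).
Proof. exact/lipschitz1_measurable/lipschitz1_shift/enorm_lipschitz1. Qed.

Lemma measurable_enorm : measurable_fun setT (@enorm R N : HT -> R).
Proof. exact/lipschitz1_measurable/enorm_lipschitz1. Qed.

Lemma measurable_vspace_shift V x :
  measurable ([set z | x + z \in V] : set HT).
Proof.
have [f [fL _ Vf]] := vspace_lipschitz V.
have mf : measurable_fun setT ((fun z => f (x + z)) : HT -> R).
  exact/lipschitz1_measurable/lipschitz1_shift.
have := mf measurableT _ (measurable_set1 (0 : R)); rewrite setTI.
by congr measurable; apply/seteqP; split=> z /= /Vf.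
Qed.

Lemma measurable_vspace V : measurable ([set z | z \in V] : set HT).
Proof.
have := measurable_vspace_shift V 0.
by congr measurable; apply/seteqP; split=> z /=; rewrite add0r.
Qed.

Lemma measurable_enorm_ge (r : R) : measurable ([set z | r <= enorm z] : set HT).
Proof.
have := measurable_enorm measurableT (measurable_itv `[r, +oo[); rewrite setTI.
by congr measurable; apply/seteqP; split=> z /=; rewrite in_itv/= andbT.
Qed.

Lemma measurable_enorm_lt (r : R) : measurable ([set z | enorm z < r] : set HT).
Proof.
have := measurable_enorm measurableT (measurable_itv `]-oo, r[); rewrite setTI.
by congr measurable; apply/seteqP; split=> z /=; rewrite in_itv/=.
Qed.

Lemma measurable_J_domain V (e : R) : measurable (J_domain V e : set HT).
Proof.
rewrite (_ : J_domain V e = [set z | z \in V] `&` [set z | e <= enorm z])//.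
by apply: measurableI; [exact: measurable_vspace|exact: measurable_enorm_ge].
Qed.

Lemma measurable_enorm_powR (D : set HT) (p : R) :
  measurable_fun D ((fun z => enorm z `^ p) : HT -> R).
Proof.
apply: measurable_funTS.
exact: (measurableT_comp (measurable_powR p) measurable_enorm).
Qed.

End HausdorffMeasurable.

Section TailIntegral.
Context {R : realType} {N : nat}.
Variables (V : {vspace 'rV[R]_N}) (s : R).
Hypothesis s0 : 0 < s.
Local Notation n := (\dim V).
Local Notation p := (n%:R + 2 * s).
Local Notation mu := (hausdorff_measure R N n).

(** On the dyadic annulus [r 2^j <= |z| < r 2^(j+1)] of [V] the measure is at
    most a multiple of [2^(j n)] and the integrand at most a multiple of
    [2^(-j p)], so that the integral is dominated by a geometric series of
    ratio [2^(-2 s)]. *)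
Lemma integral_tail_lty (r : R) : 0 < r ->
  (\int[mu]_(z in J_domain V r) (enorm z `^ (- p))%:E < +oo)%E.
Proof.
move=> r0.
pose F (j : nat) : set (@hausdorff_type R N n) :=
  J_domain V (r * 2 ^+ j) `&` [set z | enorm z < r * 2 ^+ j.+1].
have two0 j : 0 < (2 : R) ^+ j by rewrite exprn_gt0.
have FD : J_domain V r = \bigcup_j F j.
  apply/seteqP; split=> [z [zV rz]|z [j _ [[zV rz] _]]]; last first.
    split=> //; apply: le_trans rz; rewrite ler_peMr ?(ltW r0)//.
    by rewrite exprn_ege1// ler1n.
  have ex : exists j, enorm z < r * 2 ^+ j.+1.
    exists (Num.bound (enorm z / r)).
    rewrite -ltr_pdivrMl// mulrC; apply: lt_le_trans (archi_boundP _) _.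
      by rewrite divr_ge0 ?enorm_ge0// ltW.
    by rewrite -natrX ler_nat ltnW// (ltn_trans (ltnSn _))// ltn_expl.
  case: (ex_minnP ex) => j zj jmin; exists j => //; split=> //; split=> //.
  case: j zj jmin => [|j] zj jmin; first by rewrite expr0 mulr1.
  by rewrite leNgt; apply/negP => /jmin; rewrite ltnn.
have mF j : measurable (F j).
  by apply: measurableI; [exact: measurable_J_domain|exact: measurable_enorm_lt].
have tF : trivIset setT F.
  suff H i j : (i < j)%N -> F i `&` F j = set0.
    by apply/trivIsetP => i j _ _; rewrite neq_ltn => /orP[/H//|/H]; rewrite setIC.
  move=> ij; rewrite -subset0 => z [[_ zi] [[_ zj] _]] /=.
  have := le_lt_trans zj zi; rewrite ltNge => /negP; apply.
  by rewrite ler_pM2l// ler_weXn2l// ler1n.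
have mf (D : set (@hausdorff_type R N n)) :
    measurable_fun D (fun z => (enorm z `^ (- p))%:E).
  exact/measurable_EFinP/measurable_enorm_powR.
have f0 (z : 'rV[R]_N) : (0 <= (enorm z `^ (- p))%:E)%E.
  by rewrite lee_fin powR_ge0.
rewrite FD ge0_integral_bigcup//.
pose q : R := 2 `^ (- p) * 2 ^+ n.
pose c : R := r `^ (- p) * (ball_const n * (2 * r) ^+ n).
have c0 : 0 <= c.
  rewrite mulr_ge0 ?powR_ge0// mulr_ge0 ?ball_const_ge0// exprn_ge0//.
  by rewrite mulr_ge0// ltW.
have q0 : 0 < q by rewrite mulr_gt0// powR_gt0.
have q1 : q < 1.
  rewrite /q opprD powRD; last by rewrite pnatr_eq0 implybT.
  rewrite powRN powR_mulrn// mulrAC mulVf ?mul1r ?gt_eqF//.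
  rewrite powRN invf_lt1 ?powR_gt0//.
  have s2 : 0 < 2 * s by rewrite mulr_gt0.
  have : (1 : R) `^ (2 * s) < 2 `^ (2 * s).
    by apply: gt0_ltr_powR; rewrite ?nnegrE// ltr1n.
  by rewrite powR1.
have Fj j : (\int[mu]_(z in F j) (enorm z `^ (- p))%:E <= (c * q ^+ j)%:E)%E.
  have rj : 0 < r * 2 ^+ j by rewrite mulr_gt0.
  apply: (@le_trans _ _
    (\int[mu]_(z in F j) cst ((r * 2 ^+ j) `^ (- p))%:E z)%E).
    apply: ge0_le_integral => //.
    move=> z [[_ zj] _]; have z0 := lt_le_trans rj zj.
    rewrite lee_fin !powRN lef_pV2 ?posrE ?powR_gt0//.
    apply: ge0_ler_powR; rewrite ?nnegrE ?(ltW rj) ?(ltW z0)//.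
    by rewrite ltW// ltr_wpDl// mulr_gt0.
  rewrite [leLHS](integral_cst mu (mF j)).
  have rj1 : 0 < r * 2 ^+ j.+1 by rewrite mulr_gt0.
  apply: (@le_trans _ _ (((r * 2 ^+ j) `^ (- p))%:E *
      (ball_const n * (r * 2 ^+ j.+1) ^+ n)%:E)%E).
    apply: lee_wpmul2l; first by rewrite lee_fin powR_ge0.
    apply: le_trans (hausdorff_vspace_ball V rj1).
    by apply: le_hausdorff => z [[zV _] zj].
  rewrite -EFinM lee_fin powRM ?(ltW r0) ?(ltW (two0 _))//.
  rewrite -powR_mulrn// -powRrM mulrC [j%:R * _]mulrC powRrM.
  rewrite powR_mulrn ?powR_ge0//.
  rewrite exprS mulrA (mulrC r) exprMn -exprM mulnC exprM /c /q exprMn.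
  rewrite le_eqVlt; apply/orP; left; apply/eqP; rewrite exprMn; ring.
apply: (@le_lt_trans _ _ (c / (1 - q))%:E); last by rewrite ltry.
apply: lime_le.
  by apply: is_cvg_nneseries => k _ _; apply: integral_ge0.
near=> K; apply: (@le_trans _ _ (\sum_(0 <= j < K) (c * q ^+ j)%:E)%E).
  by apply: lee_sum => j _; exact: Fj.
rewrite sumEFin lee_fin; have := @geometric_le_lim R K c q c0 q0.
by apply; rewrite ger0_norm// ltW.
Unshelve. all: by end_near. Qed.

Lemma integrable_tail (r : R) : 0 < r ->
  mu.-integrable (J_domain V r) (EFin \o fun z => enorm z `^ (- p)).
Proof.
move=> r0; apply/integrableP; split.
  exact/measurable_EFinP/measurable_enorm_powR.
under eq_integral => z _ do rewrite /= ger0_norm ?powR_ge0//.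
exact: integral_tail_lty.
Qed.

End TailIntegral.

(** * The operators at points of the ball *)

Section BallAndSubspaces.
Context {R : realType} {N l : nat}.
Variables (S : 'I_l -> {vspace 'rV[R]_N}) (s : R).
Hypothesis s0 : 0 < s.
Implicit Types (V : {vspace 'rV[R]_N}) (x z : 'rV[R]_N).

(** [u_ex] with arbitrary subspaces in place of the blocks. *)
Definition well x : R :=
  if (enorm x <= 1) || [exists i, x \in S i] then 0 else -1.

Lemma well_ball x : enorm x <= 1 -> well x = 0.
Proof. by move=> x1; rewrite /well x1. Qed.

Lemma well_in i x : x \in S i -> well x = 0.
Proof.
move=> xS; rewrite /well; case: ifPn => // /norP[_ /existsPn/(_ i)].
by rewrite xS.
Qed.

Lemma well_out x : 1 < enorm x -> (forall i, x \notin S i) -> well x = -1.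
Proof.
move=> x1 xS; rewrite /well leNgt x1/= ifF//.
by apply/negbTE/existsPn.
Qed.

Lemma well_le0 x : well x <= 0.
Proof. by rewrite /well; case: ifP => //; rewrite lerN10. Qed.

Lemma norm_well x : `|well x| <= 1.
Proof. by rewrite /well; case: ifP => _; rewrite ?normr0 ?normrN1. Qed.

Lemma measurable_well_shift n x :
  measurable_fun setT ((fun z => well (x + z)) : @hausdorff_type R N n -> R).
Proof.
apply: measurable_fun_ifT; [|exact: measurable_cst..].
apply: (@measurable_fun_bool _ _ _ _ true).
have mball := measurable_enorm_shift (n := n) x measurableT
  (measurable_itv `]-oo, 1]).
have mS : measurable (\bigcup_(i in [set: 'I_l])
    ([set z | x + z \in S i] : set (@hausdorff_type R N n))).
  by apply: fin_bigcup_measurable => // i _; exact: measurable_vspace_shift.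
have := measurableU _ _ mball mS; rewrite !setTI.
congr measurable; apply/seteqP; split=> z /=; rewrite in_itv/=.
  by move=> [->//|[i _ /= zi]]; apply/orP; right; apply/existsP; exists i.
by move=> /orP[|/existsP[i zi]]; [left|right; exists i].
Qed.

Local Notation mu V := (hausdorff_measure R N (\dim V)).

Lemma measurable_J_integrand V x (D : set (@hausdorff_type R N (\dim V))) :
  measurable_fun D (J_integrand s V well x).
Proof.
apply: measurable_funTS; rewrite /J_integrand.
under eq_fun => z do rewrite -powRN.
apply: measurable_funM; last exact: measurable_enorm_powR.
by apply: measurable_funB; [exact: measurable_well_shift|exact: measurable_cst].
Qed.

Section AtPoint.
Variable x : 'rV[R]_N.
Hypothesis x1 : enorm x < 1.

Let ux : well x = 0. Proof. by rewrite well_ball// ltW. Qed.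

Lemma J_integrand_le0 V z : J_integrand s V well x z <= 0.
Proof.
by rewrite /J_integrand ux subr0 mulr_le0_ge0 ?well_le0// invr_ge0 powR_ge0.
Qed.

Lemma J_integrable V (e : R) : 0 < e ->
  (mu V).-integrable (J_domain V e) (EFin \o J_integrand s V well x).
Proof.
move=> e0; apply: le_integrable (integrable_tail V s0 e0).
- exact: measurable_J_domain.
- exact/measurable_EFinP/measurable_J_integrand.
move=> z _ /=; rewrite lee_fin /J_integrand ux subr0 normrM powRN.
by rewrite ler_piMl// norm_well.
Qed.

(** The integrand vanishes on the ball of radius [1 - |x|] about the origin, so
    that the principal value is not a genuine limit. *)
Lemma J_trunc_stationary V (e : R) : e <= 1 - enorm x ->
  J_trunc s V well x e = J_trunc s V well x (1 - enorm x).
Proof.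
move=> ex; rewrite /J_trunc Rintegral_mkcond [RHS]Rintegral_mkcond.
congr Rintegral; apply/funext => z; rewrite !patchE.
have [z1|z1] := leP (1 - enorm x) (enorm z).
  by congr (if _ then _ else _); apply/idP/idP => /set_mem[zV _];
    apply/mem_set; split=> //; exact: le_trans z1.
rewrite [in RHS]ifF; last by apply/negP => /set_mem[_]; rewrite leNgt z1.
case: ifP => // _; rewrite /J_integrand ux well_ball ?subrr ?mul0r//.
apply: le_trans (ler_enormD _ _) _; move: z1; lra.
Qed.

Let J_near V : \forall e \near 0^'+,
  J_trunc s V well x e = J_trunc s V well x (1 - enorm x).
Proof.
near=> e; apply: J_trunc_stationary; near: e.
by apply: nbhs_right_le; rewrite subr_gt0.
Unshelve. all: by end_near. Qed.

Lemma J_well_defined V : J_defined s V well x.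
Proof.
split; first exact: J_integrable.
exact: is_cvg_near_cst (J_near V).
Qed.

Lemma J_opE (C : nat -> R -> R) V :
  J_op C s V well x = C (\dim V) s * J_trunc s V well x (1 - enorm x).
Proof. by rewrite /J_op (lim_near_cst _ (J_near V)). Qed.

Lemma J_truncE V (e : R) : J_trunc s V well x e =
  - fine (\int[mu V]_(z in J_domain V e) (- J_integrand s V well x z)%:E)%E.
Proof.
rewrite /J_trunc /Rintegral -fineN -integral_ge0N; last first.
  by move=> z _; rewrite lee_fin oppr_ge0 J_integrand_le0.
by congr fine; apply: eq_integral => z _; rewrite -EFinN opprK.
Qed.

Lemma J_trunc_le0 V (e : R) : J_trunc s V well x e <= 0.
Proof.
rewrite J_truncE oppr_le0 fine_ge0//; apply: integral_ge0 => z _.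
by rewrite lee_fin oppr_ge0 J_integrand_le0.
Qed.

(** If [x] avoids the subspaces, the affine space [x + V] meets each of them in
    a set of dimension less than [\dim V], hence null. *)
Lemma hausdorff_slice V : (forall i, x \notin S i) -> forall i,
  hausdorff (\dim V) [set z | z \in V /\ x + z \in S i] = 0%E.
Proof.
move=> xS i.
have [[a [aV aS]]|Hn] := pselect (exists a, a \in V /\ x + a \in S i).
  apply/eqP; rewrite eq_le hausdorff_ge0 andbT.
  have dW : (\dim (V :&: S i) < \dim V)%N.
    have [le_d eq_d] := dimv_leqif_sup (capvSl V (S i)).
    rewrite ltn_neqAle le_d eq_d andbT; apply: contra (xS i) => VS.
    have aS' : a \in S i.
      by have /subvP/(_ a aV) := VS; rewrite memv_cap => /andP[].
    by rewrite -(addrK a x) memvB.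
  rewrite -(hausdorff_affine_lt a dW); apply: le_hausdorff => z [zV zS] /=.
  rewrite memv_cap memvB//=.
  by rewrite (_ : z - a = (x + z) - (x + a)) ?memvB// opprD addrACA subrr add0r.
rewrite (_ : [set _ | _] = set0) ?hausdorff0// -subset0 => z zP.
by apply: Hn; exists z.
Qed.

(** The least value of the kernel on [|z| <= 4 n], times a lower bound for the
    measure of a unit cube. *)
Definition jump (n : nat) : R :=
  (4 * n%:R) `^ (- (n%:R + 2 * s)) * cube_const n.

(** A unit cube of [V] lies in the annulus [2 <= |z| < 4 n]. There, away from
    the null slices, [u (x + z) = -1], as [|x + z| > 1]; so the integrand is at most
    [- (4 n)^(-n-2s)]. *)
Lemma J_trunc_jump V (e : R) : (0 < \dim V)%N -> 0 < e <= 2 ->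
  (forall i, x \notin S i) -> J_trunc s V well x e <= - jump (\dim V).
Proof.
move=> n0 /andP[e0 e2] xS; rewrite J_truncE lerN2.
set n := \dim V in n0 *; pose g z := - J_integrand s V well x z.
have g0 z : (0 <= (g z)%:E)%E by rewrite lee_fin oppr_ge0 J_integrand_le0.
have mg (D : set (@hausdorff_type R N n)) : measurable_fun D (EFin \o g).
  apply/measurable_EFinP; rewrite /g; apply: measurableT_comp => //.
  exact: measurable_J_integrand.
pose E : set (@hausdorff_type R N n) := (J_domain V 2 `&`
  [set z | enorm z < 4 * n%:R]) `&`
  ~` (\bigcup_(i in [set: 'I_l]) [set z | x + z \in S i]).
have mE : measurable E.
  apply: measurableI.
    by apply: measurableI; [exact: measurable_J_domain|exact: measurable_enorm_lt].
  apply: measurableC; apply: fin_bigcup_measurable => // i _.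
  exact: measurable_vspace_shift.
have n0R : 0 < n%:R :> R by rewrite ltr0n.
have gE z : E z -> (4 * n%:R) `^ (- (n%:R + 2 * s)) <= g z.
  move=> [[[zV z2] z4] zS]; rewrite /g /J_integrand ux subr0 well_out.
  - rewrite mulN1r opprK -powRN !powRN lef_pV2 ?posrE ?powR_gt0 ?mulr_gt0//.
      apply: ge0_ler_powR; rewrite ?nnegrE ?enorm_ge0 ?mulr_ge0 ?(ltW z4)//.
      by rewrite addr_ge0// mulr_ge0// ltW.
    by apply: lt_le_trans z2.
  - have := ler_enormD (x + z) (- x); rewrite addrAC subrr add0r enormN.
    by move: z2 x1; lra.
  - by move=> i; apply/negP => zi; apply: zS; exists i.
have cubeE : ((cube_const n)%:E <= hausdorff n E)%E.
  have [B [BB BV]] := orthonormal_basis V.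
  apply: le_trans (unit_cube_hausdorff BB n0) _.
  (* The slices are indexed by [nat], for countable subadditivity. *)
  pose Z (j : nat) : set 'rV[R]_N :=
    [set z | exists2 i : 'I_l, i = j :> nat & z \in V /\ x + z \in S i].
  have Z0 j : hausdorff n (Z j) = 0%E.
    have [jl|lj] := ltnP j l.
      apply/eqP; rewrite eq_le hausdorff_ge0 andbT.
      rewrite -(hausdorff_slice V xS (Ordinal jl)); apply: le_hausdorff.
      by move=> z [i ij]; rewrite (_ : i = Ordinal jl)//; exact: val_inj.
    rewrite (_ : Z j = set0) ?hausdorff0// -subset0 => z [i ij].
    by have := ltn_ord i; rewrite ij ltnNge lj.
  have Zn : hausdorff n (\bigcup_j Z j) = 0%E.
    apply/eqP; rewrite eq_le hausdorff_ge0 andbT.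
    apply: le_trans (hausdorff_sigma_subadditive n _) _.
    by rewrite eseries0// => j _ _; exact: Z0.
  apply: (@le_trans _ _
    (hausdorff n E + hausdorff n (\bigcup_j Z j))%E); last first.
    by rewrite Zn adde0.
  apply: le_trans (outer_measureU2 (hausdorff_outer n) _ _).
  apply: (le_hausdorff n) => _ [c -> c23].
  have cV : c *m B \in V by apply/BV; exists c.
  have [[i zi]|zS] := pselect (exists i, x + c *m B \in S i).
    by right; exists (val i) => //; exists i.
  left; split; last by move=> [i _ zi]; apply: zS; exists i.
  split; first split=> //; rewrite /= enorm_mulmx//.
    apply: le_trans (enorm_coord c (Ordinal n0)).
    by have /andP[c2 _] := c23 (Ordinal n0); apply: le_trans c2 (ler_norm _).
  apply: (@le_lt_trans _ _ (n%:R * 3)).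
    apply: enorm_le_card => i; have /andP[c2 c3] := c23 i.
    by rewrite ger0_norm//; apply: le_trans c2.
  by rewrite mulrC ltr_pM2r// ltr_nat.
have mD := @measurable_J_domain R N n V e.
have gfin : (\int[mu V]_(z in J_domain V e) (g z)%:E)%E \is a fin_num.
  rewrite ge0_fin_numE; last exact: integral_ge0.
  have /integrableP[_] := J_integrable V e0.
  by under eq_integral => z _ do rewrite /= ler0_norm ?J_integrand_le0//.
rewrite -lee_fin fineK//.
apply: (@le_trans _ _ (\int[mu V]_(z in E) (g z)%:E)%E); last first.
  apply: ge0_subset_integral => // z [[[zV z2] _] _]; split=> //.
  exact: le_trans z2.
apply: (@le_trans _ _
    (\int[mu V]_(z in E) cst ((4 * n%:R) `^ (- (n%:R + 2 * s)))%:E z)%E);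
  last first.
  apply: ge0_le_integral => //.
  by move=> z _; rewrite lee_fin powR_ge0.
rewrite (integral_cst (mu V) mE) EFinM.
by apply: lee_wpmul2l; rewrite ?lee_fin ?powR_ge0.
Qed.

End AtPoint.

Lemma jump_gt0 n : (0 < n)%N -> 0 < jump n.
Proof.
by move=> n0; rewrite mulr_gt0 ?cube_const_gt0// powR_gt0// mulr_gt0// ltr0n.
Qed.

End BallAndSubspaces.

(** * Coordinate blocks and the discontinuity *)

Section NearZero.
Context {R : realType} {N : nat}.
Implicit Types (f : 'rV[R]_N -> R) (x v : 'rV[R]_N).

Lemma near0_continuous f x : (\near x, f x = 0) -> {for x, continuous f}.
Proof.
move=> fx; have fx0 : f x = 0 := nbhs_singleton fx.
rewrite /prop_for /continuous_at fx0.
exact: (@cvg_near_cst _ R 0 f (nbhs x) _ fx).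
Qed.

Lemma near0_derivable f x v : (\near x, f x = 0) -> derivable f x v.
Proof.
move=> fx; apply: (@near_eq_derivable _ _ _ (cst 0)) (derivable_cst _ _ _).
by apply: filterS fx => y ->.
Qed.

Lemma near0_derive f x v : (\near x, f x = 0) -> \near x, 'D_v f x = 0.
Proof.
move=> /near_join; apply: filterS => y fy.
rewrite (@near_eq_derive _ _ _ _ (cst 0)) ?derive_cst//.
Qed.

Lemma near0_C2 (D : set 'rV[R]_N) f :
  (forall x, D x -> \near x, f x = 0) -> C2_on D f.
Proof.
move=> Df x /Df fx; split=> [|m]; first exact: near0_continuous.
have dfx := near0_derive (ebasis m) fx.
split; [exact: near0_derivable|exact: near0_continuous|move=> p; split].
  exact: near0_derivable.
exact/near0_continuous/near0_derive.
Qed.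

End NearZero.

Section Blocks.
Context {R : realType} {N l : nat}.
Variable k : 'I_l -> nat.
Hypothesis k_sum : (\sum_(i < l) k i <= N)%N.
Implicit Types (i j : 'I_l).

Lemma block_end i :
  (\sum_(j < l | (j <= i)%N) k j = \sum_(j < l | (j < i)%N) k j + k i)%N.
Proof.
rewrite (bigD1 i)//= addnC; congr (_ + _)%N; apply: eq_bigl => j.
by rewrite ltn_neqAle andbC.
Qed.

Lemma block_end_le i : (\sum_(j < l | (j <= i)%N) k j <= N)%N.
Proof.
apply: leq_trans k_sum; rewrite [leqRHS](bigID (fun j : 'I_l => (j <= i)%N))/=.
exact: leq_addr.
Qed.

Lemma block_end_start i j : (i < j)%N ->
  (\sum_(m < l | (m <= i)%N) k m <= \sum_(m < l | (m < j)%N) k m)%N.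
Proof.
move=> ij; rewrite [leqRHS](bigID (fun m : 'I_l => (m <= i)%N))/=.
rewrite (eq_bigl (fun m : 'I_l => (m < j)%N && (m <= i)%N)) ?leq_addr// => m.
by case: (leqP m i) => mi; rewrite ?andbF// (leq_ltn_trans mi ij).
Qed.

Lemma card_A_block i : #|A_block k i : {set 'I_N}| = k i.
Proof.
have lt_N (j : 'I_(k i)) : (\sum_(m < l | (m < i)%N) k m + j < N)%N.
  by apply: leq_trans (block_end_le i); rewrite block_end ltn_add2l.
pose f (j : 'I_(k i)) : 'I_N := Ordinal (lt_N j).
have finj : injective f by move=> j j' /(congr1 val)/addnI/val_inj.
rewrite -[RHS]card_ord -(card_imset _ finj); congr #|pred_of_set _|.
apply/setP => m; rewrite inE block_end.
apply/andP/imsetP => [[am mb]|[j _ ->]]; last by rewrite leq_addr ltn_add2l.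
have jk : (m - \sum_(m < l | (m < i)%N) k m < k i)%N by rewrite ltn_subLR.
by exists (Ordinal jk) => //; apply/val_inj; rewrite /= subnKC.
Qed.

Lemma A_block_inj i j (m : 'I_N) :
  m \in A_block k i -> m \in A_block k j -> i = j.
Proof.
rewrite !inE => /andP[ai bi] /andP[aj bj]; apply/val_inj/eqP => /=.
case: ltngtP => // ij; have := block_end_start ij.
  by rewrite leqNgt (leq_ltn_trans aj bi).
by rewrite leqNgt (leq_ltn_trans ai bj).
Qed.

Lemma ebasisE (m p : 'I_N) : (ebasis m : 'rV[R]_N) 0 p = (p == m)%:R.
Proof. by rewrite mxE eqxx. Qed.

Lemma block_span_support i (v : 'rV[R]_N) (m : 'I_N) :
  v \in block_span k i -> m \notin A_block k i -> v 0 m = 0.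
Proof.
rewrite /block_span; set X := [seq _ | _ <- _] => vX mA.
rewrite (coord_span (X := in_tuple X) vX) summxE big1// => j _.
rewrite mxE; have /mapP[p] := mem_nth 0 (ltn_ord j).
rewrite mem_enum => pA ->; rewrite ebasisE.
by rewrite (_ : (m == p) = false) ?mulr0//; apply: contraNF mA => /eqP ->.
Qed.

Lemma ebasis_block_span i (m : 'I_N) :
  (ebasis m : 'rV[R]_N) \in block_span k i ->
  m \in A_block k i.
Proof.
move=> mS; apply/negPn/negP => /(block_span_support mS)/eqP.
by rewrite ebasisE eqxx oner_eq0.
Qed.

Lemma dim_block_span i : \dim (block_span k i : {vspace 'rV[R]_N}) = k i.
Proof.
rewrite -[RHS]card_A_block cardE -(size_map (@ebasis R N)).
set X := [seq ebasis m | m <- enum (A_block k i)].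
suff /eqP : free (in_tuple X) by [].
apply/freeP => c c0 j.
have jA : (j < size (enum (A_block k i : {set 'I_N})))%N.
  by have := ltn_ord j; rewrite [X in (_ < X)%N]size_map.
have m0 : 'I_N by case: (enum _) jA => [//|m *].
have /(congr1 (fun v : 'rV[R]_N => v 0 (nth m0 (enum (A_block k i)) j))) := c0.
rewrite summxE (bigD1 j)//= big1 => [|j' j'j].
  by rewrite addr0 !mxE (nth_map m0)// ebasisE eqxx mulr1.
have j'A : (j' < size (enum (A_block k i : {set 'I_N})))%N.
  by have := ltn_ord j'; rewrite [X in (_ < X)%N]size_map.
rewrite !mxE (nth_map m0)// ebasisE nth_uniq ?enum_uniq//.
by rewrite eq_sym -val_eqE/= in j'j; rewrite (negbTE j'j) mulr0.
Qed.

Lemma block_span_admissible :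
  admissible k (block_span k : 'I_l -> {vspace 'rV[R]_N}).
Proof.
split=> [i|i j ij v w vi wj]; first exact: dim_block_span.
rewrite /edot big1// => m _.
have [mi|mi] := boolP (m \in A_block k i); last first.
  by rewrite (block_span_support vi mi) mul0r.
have [mj|mj] := boolP (m \in A_block k j); last first.
  by rewrite (block_span_support wj mj) mulr0.
by have := A_block_inj mi mj => ji; rewrite ji eqxx in ij.
Qed.

Lemma A_block_neq0 i : (0 < k i)%N -> exists m : 'I_N, m \in A_block k i.
Proof. by rewrite -card_A_block => /card_gt0P. Qed.

(** With two blocks, a sum of basis vectors from each; with one proper block,
    a basis vector outside it. *)
Lemma exists_off_blocks : (0 < l)%N -> (forall i, (0 < k i)%N) ->
  (forall i, l = 1%N -> (k i < N)%N) ->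
  exists w : 'rV[R]_N, forall i, w \notin block_span k i.
Proof.
move=> l0 k0 k1; have [l1|l1] := leqP l 1.
  have {l1} l1 : l = 1%N by apply/eqP; rewrite eqn_leq l1.
  pose i0 := Ordinal l0.
  have /subsetPn[m _ mA] : ~~ ([set: 'I_N]%SET \subset A_block k i0).
    apply/negP => /subset_leq_card; rewrite cardsT card_ord card_A_block.
    by rewrite leqNgt k1.
  exists (ebasis m) => i; apply: contra mA => /ebasis_block_span.
  rewrite (_ : i = i0)//; apply/val_inj => /=.
  by apply/eqP; rewrite -leqn0 -ltnS; apply: leq_trans (ltn_ord i) (eq_leq l1).
have [m0 m0A] := A_block_neq0 (k0 (Ordinal l0)).
have [m1 m1A] := A_block_neq0 (k0 (Ordinal l1)).
have m01 : m0 != m1.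
  by apply/eqP => m01; rewrite m01 in m0A; have := A_block_inj m0A m1A.
exists (ebasis m0 + ebasis m1) => i; apply/negP => wS.
have inA m : (m == m0) || (m == m1) -> m \in A_block k i.
  move=> mm; apply/negPn/negP => /(block_span_support wS)/eqP.
  rewrite mxE !ebasisE; case/orP: mm => /eqP ->; rewrite eqxx.
    by rewrite (negbTE m01) addr0 oner_eq0.
  by rewrite (eq_sym m1) (negbTE m01) add0r oner_eq0.
have m0i : m0 \in A_block k i by rewrite inA ?eqxx.
have m1i : m1 \in A_block k i by rewrite inA ?eqxx ?orbT.
by have := A_block_inj m0i m0A; rewrite (A_block_inj m1i m1A).
Qed.

End Blocks.

Section Kplus.
Context {R : realType} {N l : nat}.
Variables (k : 'I_l -> nat) (C : nat -> R -> R) (s : R).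
Hypothesis s01 : 0 < s < 1.
Hypothesis C_gt0 :
  forall (n : nat) (t : R), (0 < n)%N -> 0 < t < 1 -> 0 < C n t.
Hypothesis l_gt0 : (0 < l)%N.
Hypothesis k_gt0 : forall i, (0 < k i)%N.
Hypothesis k_sum : (\sum_(i < l) k i <= N)%N.
Local Notation u := (u_ex k : 'rV[R]_N -> R).

Let s0 : 0 < s. Proof. by case/andP: s01. Qed.

Lemma u_ex_class : Kplus_class (eball 1) u.
Proof.
split.
  have mu : measurable_fun setT (u : @hausdorff_type R N N -> R).
    rewrite (_ : u = fun z => well (block_span k) (0 + z)).
      exact: measurable_well_shift.
    by apply/funext => z; rewrite add0r.
  apply/andP; split; first by rewrite inE.
  rewrite inE /= /finite_norm unlock /=; case: ifP => // _.
  apply: (@le_lt_trans _ _ 1%E); last exact: ltry.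
  apply/ess_supP; apply: nearW => z /=; rewrite lee_fin.
  exact: (norm_well (block_span k)).
apply: near0_C2 => x /= x1; have d0 : 0 < 1 - enorm x by rewrite subr_gt0.
apply: filterS (near_enorm x d0) => y yx.
apply: (well_ball (block_span k)); rewrite -(subrK x y).
by apply: le_trans (ler_enormD _ _) _; rewrite -lerBrDr ltW.
Qed.

Lemma J_u_le0 n (V : {vspace 'rV[R]_N}) x : \dim V = n -> (0 < n)%N ->
  enorm x < 1 -> J_op C s V u x <= 0.
Proof.
move=> Vn n0 x1; rewrite (J_opE (block_span k) s x1) Vn mulr_ge0_le0//.
  exact/ltW/C_gt0.
exact: J_trunc_le0.
Qed.

Lemma Kplus_values_le0 x : enorm x < 1 -> ubound (Kplus_values C s k u x) 0.
Proof.
move=> x1 _ [W [Wk _] <-]; apply: sumr_le0 => i _.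
exact: J_u_le0 (Wk i) (k_gt0 i) x1.
Qed.

Lemma Kplus_values_neq0 x : Kplus_values C s k u x !=set0.
Proof.
by eexists; exists (block_span k) => //; exact: block_span_admissible.
Qed.

Lemma u_ex_defined x : enorm x < 1 -> Kplus_defined C s k u x.
Proof.
move=> x1; split; last first.
  split; first exact: Kplus_values_neq0.
  by exists 0; exact: Kplus_values_le0.
by move=> W _ i; exact: (J_well_defined (block_span k) s0 x1).
Qed.

(** The value [0] is attained by the blocks, along which [u] vanishes. *)
Lemma Kplus0 : Kplus C s k u 0 = 0.
Proof.
have e0 : enorm (0 : 'rV[R]_N) < 1 by rewrite enorm0.
apply/eqP; rewrite eq_le; apply/andP; split.
  exact: ge_sup (Kplus_values_neq0 0) (Kplus_values_le0 e0).
apply: ub_le_sup; first by exists 0; exact: Kplus_values_le0.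
exists (block_span k); first exact: block_span_admissible.
apply: big1 => i _; rewrite (J_opE (block_span k) s e0).
rewrite /J_trunc /Rintegral integral0_eq /= ?mulr0//.
move=> z [zV _]; congr (_%:E); rewrite /J_integrand add0r.
rewrite (well_in zV) (well_ball (block_span k)) ?subrr ?mul0r//.
by rewrite enorm0.
Qed.

(** One of the [l] terms already contributes the jump, uniformly over the
    admissible families; the others are nonpositive. *)
Lemma Kplus_jump x (i : 'I_l) : enorm x < 1 ->
  (forall j, x \notin block_span k j) ->
  Kplus C s k u x <= - (C (k i) s * jump s (k i)).
Proof.
move=> x1 xS; apply: ge_sup (Kplus_values_neq0 x) _ => _ [W [Wk _] <-].
rewrite (bigD1 i)//= -[leRHS]addr0 lerD//; last first.
  by apply: sumr_le0 => j _; exact: J_u_le0 (Wk j) (k_gt0 j) x1.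
rewrite (J_opE (block_span k) s x1) Wk -mulrN ler_wpM2l//.
  exact/ltW/C_gt0.
rewrite -[in leRHS](Wk i); apply: J_trunc_jump => //.
  by rewrite Wk.
rewrite subr_gt0 x1/=; have := enorm_ge0 x; lra.
Qed.

(** The blocks are linear, so the multiples [t *: w] avoid them as well. *)
Lemma Kplus_not_continuous (w : 'rV[R]_N) :
  (forall i, w \notin block_span k i) ->
  ~ (Kplus C s k u x @[x --> within (eball 1) (nbhs (0 : 'rV[R]_N))]
       --> Kplus C s k u 0).
Proof.
move=> wS; pose i0 := Ordinal l_gt0; pose c := C (k i0) s * jump s (k i0).
have c0 : 0 < c by rewrite mulr_gt0 ?C_gt0 ?jump_gt0.
rewrite Kplus0 => /cvgrPdist_lt/(_ c c0); rewrite near_withinE.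
move=> /nbhs_ballP[e /= e0 He].
have w1 : 0 < 1 + enorm w by rewrite ltr_pwDl// enorm_ge0.
pose t := Num.min e 1 / 2 / (1 + enorm w).
have m0 : 0 < Num.min e 1 by rewrite lt_min e0 ltr01.
have t0 : 0 < t by rewrite divr_gt0// divr_gt0.
have tw : enorm (t *: w) < Num.min e 1.
  rewrite enormZ gtr0_norm//; apply: (@le_lt_trans _ _ (t * (1 + enorm w))).
    by rewrite ler_pM2l// lerDr.
  by rewrite divfK ?gt_eqF// ltr_pdivrMr// ltr_pMr// ltr1n.
have /= := He (t *: w); rewrite sub0r normrN => Htw.
have tw1 : enorm (t *: w) < 1.
  by apply: lt_le_trans tw _; rewrite ge_min lexx orbT.
have tS i : t *: w \notin block_span k i.
  apply: contra (wS i) => twS.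
  by rewrite -[w](scalerK (lt0r_neq0 t0)) memvZ.
have : `|Kplus C s k u (t *: w)| < c.
  apply: Htw tw1; split=> // i j; rewrite !mxE ord1 /ball/= sub0r normrN.
  apply: le_lt_trans (lt_le_trans tw _); last by rewrite ge_min lexx.
  by have := enorm_coord (t *: w) j; rewrite mxE.
have := Kplus_jump i0 tw1 tS; rewrite -/c => Kc.
by rewrite ltr_norml => /andP[/(le_lt_trans Kc)]; rewrite ltxx.
Qed.

End Kplus.

Theorem mainTheorem7 (R : realType) (N l : nat) (k : 'I_l -> nat)
    (C : nat -> R -> R) (s : R)
    (s01 : 0 < s < 1)
    (C_gt0 : forall (n : nat) (t : R), (0 < n)%N -> 0 < t < 1 -> 0 < C n t)
    (l_range : (1 <= l <= N)%N)
    (k_range : forall i : 'I_l, (1 <= k i <= N)%N)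
    (k_mono : forall i j : 'I_l, (i <= j)%N -> (k i <= k j)%N)
    (k_sum : (\sum_(i < l) k i <= N)%N)
    (not_full : l <> 1%N \/ (l = 1%N /\ forall i : 'I_l, (k i < N)%N)) :
  let u : 'rV[R]_N -> R := u_ex k in
  let Omega : set 'rV[R]_N := eball 1 in
  [/\ Kplus_class Omega u,
      forall x, Omega x -> Kplus_defined C s k u x &
      ~ (Kplus C s k u x @[x --> within Omega (nbhs (0 : 'rV[R]_N))]
           --> Kplus C s k u 0)].
Proof.
move=> u Omega; have /andP[l_gt0 _] := l_range.
have k_gt0 i : (0 < k i)%N by have /andP[] := k_range i.
have k_proper i : l = 1%N -> (k i < N)%N.
  by case: not_full => [//|[_ kN]] _.
have [w wS] := exists_off_blocks (R := R) k_sum l_gt0 k_gt0 k_proper.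
split.
- exact: u_ex_class.
- by move=> x x1; exact: u_ex_defined.
- exact: (Kplus_not_continuous s01 C_gt0 l_gt0 k_gt0 k_sum wS).
Qed.
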